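(* For every Banach $f$-algebra $A$ there exist a Banach lattice $X$, a compact Hausdorff space $K$ and a contractive injective lattice-algebra homomorphism $R\colon A\to X_0\oplus_\infty C(K)$.
   Context: All spaces are real. A vector lattice algebra is a real associative algebra that is also a vector lattice in which the product of positive elements is positive. An $f$-algebra is a vector lattice algebra such that $a\wedge b=0$ and $c\ge 0$ imply $(ac)\wedge b=0=(ca)\wedge b$. A Banach $f$-algebra is an $f$-algebra equipped with a complete, submultiplicative lattice norm (lattice norm: $|x|\le |y|$ implies $\|x\|\le\|y\|$). A lattice-algebra homomorphism is a linear map preserving the lattice operations and the product. Contractive means of operator norm at most $1$. For a Banach lattice $X$, $X_0$ denotes $X$ equipped with the identically zero product; it is a Banach $f$-algebra. $C(K)$ is the space of real continuous functions on $K$ with supremum norm and pointwise order and product. For Banach $f$-algebras $A,B$, $A\oplus_\infty B$ is their direct sum with coordinatewise operations and order and the maximum norm. *)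

(* Defs.v *)
From HB Require Import structures.
From mathcomp Require Import all_boot all_order all_algebra ring lra.
From mathcomp Require Import all_classical all_reals all_analysis.

Set Implicit Arguments.
Unset Strict Implicit.
Unset Printing Implicit Defensive.

Import Order.TTheory GRing.Theory Num.Theory.
Import numFieldNormedType.Exports.

Local Open Scope classical_set_scope.
Local Open Scope ring_scope.

Reserved Notation "x ** y" (at level 40, left associativity).

(* [`|x|] is the norm; the lattice modulus is [vabs] below. *)

(* The order is a mixin of its own because Hierarchy Builder admits no join of
   [GRing.Zmodule] and [Order.Lattice] other than [realDomainType]; the alias
   [vlattice] makes the lattice theory of [Order] available. *)
HB.mixin Record Lmodule_isVectorLattice (R : realType) V of GRing.Lmodule R V := {
  vle : rel V;
  vmeet : V -> V -> V;
  vjoin : V -> V -> V;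
  vle_refl : reflexive vle;
  vle_anti : antisymmetric vle;
  vle_trans : transitive vle;
  vle_meet : forall x y z, vle x (vmeet y z) = vle x y && vle x z;
  vjoin_le : forall x y z, vle (vjoin x y) z = vle x z && vle y z;
  vle_add2l : forall x y z, vle y z -> vle (x + y) (x + z);
  vle_scale2l : forall (a : R) x y, 0 <= a -> vle x y -> vle (a *: x) (a *: y)
}.

#[short(type="vectorLatticeType")]
HB.structure Definition VectorLattice (R : realType) :=
  { V of GRing.Lmodule R V & Lmodule_isVectorLattice R V }.

Definition vlattice (R : realType) (V : vectorLatticeType R) : Type := V.

Fact vlattice_display : Order.disp_t. Proof. exact: (Order.Disp tt tt). Qed.

HB.instance Definition _ (R : realType) (V : vectorLatticeType R) :=
  Choice.on (vlattice V).
HB.instance Definition _ (R : realType) (V : vectorLatticeType R) :=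
  Order.Le_isPOrder.Build vlattice_display (vlattice V)
    (@vle_refl R V) (@vle_anti R V) (@vle_trans R V).
HB.instance Definition _ (R : realType) (V : vectorLatticeType R) :=
  Order.POrder_isMeetSemilattice.Build vlattice_display (vlattice V)
    (@vle_meet R V).
HB.instance Definition _ (R : realType) (V : vectorLatticeType R) :=
  Order.POrder_isJoinSemilattice.Build vlattice_display (vlattice V)
    (@vjoin_le R V).

Definition vabs (R : realType) (V : vectorLatticeType R) (x : V) : V :=
  vjoin x (- x).

HB.mixin Record hasLatticeNorm (R : realType) V
    of CompleteNormedModule R V & VectorLattice R V := {
  lattice_norm : forall x y : V, vle (vabs x) (vabs y) -> `|x| <= `|y|
}.

#[short(type="banachLatticeType")]
HB.structure Definition BanachLattice (R : realType) :=
  { V of CompleteNormedModule R V & VectorLattice R V & hasLatticeNorm R V }.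

(* Associative algebras without a unit: [GRing.Algebra] requires a unit with
   [1 != 0]. *)
HB.mixin Record Lmodule_isAssocAlgebra (R : realType) A of GRing.Lmodule R A := {
  amul : A -> A -> A;
  amulA : associative amul;
  amulDl : left_distributive amul +%R;
  amulDr : right_distributive amul +%R;
  amulZl : forall (k : R) x y, amul (k *: x) y = k *: amul x y;
  amulZr : forall (k : R) x y, amul x (k *: y) = k *: amul x y
}.

#[short(type="assocAlgType")]
HB.structure Definition AssocAlgebra (R : realType) :=
  { A of GRing.Lmodule R A & Lmodule_isAssocAlgebra R A }.

Notation "x ** y" := (amul x y) : ring_scope.

HB.mixin Record VectorLattice_isAlgebra (R : realType) A
    of VectorLattice R A & AssocAlgebra R A := {
  amul_ge0 : forall x y : A, vle 0 x -> vle 0 y -> vle 0 (x ** y)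
}.

#[short(type="vectorLatticeAlgType")]
HB.structure Definition VectorLatticeAlgebra (R : realType) :=
  { A of VectorLattice R A & AssocAlgebra R A & VectorLattice_isAlgebra R A }.

HB.mixin Record VectorLatticeAlgebra_isFAlgebra (R : realType) A
    of VectorLatticeAlgebra R A := {
  falg_disjoint : forall a b c : A, vmeet a b = 0 -> vle 0 c ->
    vmeet (a ** c) b = 0 /\ vmeet (c ** a) b = 0
}.

#[short(type="fAlgType")]
HB.structure Definition FAlgebra (R : realType) :=
  { A of VectorLatticeAlgebra R A & VectorLatticeAlgebra_isFAlgebra R A }.

HB.mixin Record hasSubmultiplicativeNorm (R : realType) A
    of BanachLattice R A & FAlgebra R A := {
  normr_amul : forall x y : A, `|x ** y| <= `|x| * `|y|
}.

#[short(type="banachFAlgType")]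
HB.structure Definition BanachFAlgebra (R : realType) :=
  { A of BanachLattice R A & FAlgebra R A & hasSubmultiplicativeNorm R A }.

Definition lattice_algebra_hom (R : realType) (A B : vectorLatticeAlgType R)
    (f : A -> B) : Prop :=
  [/\ linear f,
      {morph f : x y / vmeet x y},
      {morph f : x y / vjoin x y} &
      {morph f : x y / x ** y}].

Definition operator_norm (R : realType) (V W : normedModType R) (f : V -> W)
  : \bar R := ereal_sup [set (`|f x|)%:E | x in [set x : V | `|x| <= 1]].

Definition contractive (R : realType) (V W : normedModType R) (f : V -> W)
  : Prop := (operator_norm f <= 1)%E.

Definition zero_product (R : realType) (X : banachLatticeType R) : Type := X.

Section ZeroProduct.
Variables (R : realType) (X : banachLatticeType R).
Local Notation X0 := (zero_product X).

HB.instance Definition _ := BanachLattice.on X0.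

Let mul0 (x y : X0) : X0 := 0.

Fact zero_mulA : associative mul0. Proof. by []. Qed.
Fact zero_mulDl : left_distributive mul0 +%R.
Proof. by move=> *; rewrite /mul0 addr0. Qed.
Fact zero_mulDr : right_distributive mul0 +%R.
Proof. by move=> *; rewrite /mul0 addr0. Qed.
Fact zero_mulZl (k : R) x y : mul0 (k *: x) y = k *: mul0 x y.
Proof. by rewrite /mul0 scaler0. Qed.
Fact zero_mulZr (k : R) x y : mul0 x (k *: y) = k *: mul0 x y.
Proof. by rewrite /mul0 scaler0. Qed.

HB.instance Definition _ := @Lmodule_isAssocAlgebra.Build R X0
  mul0 zero_mulA zero_mulDl zero_mulDr zero_mulZl zero_mulZr.

Fact zero_mul_ge0 (x y : X0) : vle 0 x -> vle 0 y -> vle 0 (x ** y).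
Proof. by rewrite /amul/= /mul0 vle_refl. Qed.

HB.instance Definition _ := @VectorLattice_isAlgebra.Build R X0 zero_mul_ge0.

Fact zero_falg (a b c : X0) : vmeet a b = 0 -> vle 0 c ->
  vmeet (a ** c) b = 0 /\ vmeet (c ** a) b = 0.
Proof.
move=> ab0 _; rewrite /amul/= /mul0; suff -> : vmeet 0 b = 0 by [].
apply: (@meet_l _ (vlattice X)).
by rewrite -ab0; exact: (@leIr _ (vlattice X)).
Qed.

HB.instance Definition _ := @VectorLatticeAlgebra_isFAlgebra.Build R X0 zero_falg.

Fact zero_normM (x y : X0) : `|x ** y| <= `|x| * `|y|.
Proof. by rewrite /amul/= /mul0 normr0 mulr_ge0. Qed.

HB.instance Definition _ := @hasSubmultiplicativeNorm.Build R X0 zero_normM.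

End ZeroProduct.

HB.mixin Record Topological_isCompactHausdorff K of Topological K := {
  compactT : compact [set: K];
  hausdorffT : hausdorff_space K
}.

#[short(type="compactHausdorffType")]
HB.structure Definition CompactHausdorff :=
  { K of Topological K & Topological_isCompactHausdorff K }.

Definition cspace (R : realType) (K : compactHausdorffType) : Type :=
  continuousType K R.

Section CSpace.
Variables (R : realType) (K : compactHausdorffType).
Local Notation CK := (cspace R K).

HB.instance Definition _ := Choice.on CK.

Definition cspace_fun (f : CK) : K -> R := (f : continuousType K R).
Local Coercion cspace_fun : cspace >-> Funclass.

Definition mkcspace (f : K -> R) (cf : continuous f) : CK :=
  (mkcts cf : continuousType K R).

Fact cspaceP (f g : CK) : (forall t, f t = g t) -> f = g.
Proof. by move=> fg; apply/continuousEP => t; exact: fg. Qed.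

Fact cspace_cts (f : CK) : continuous f.
Proof. exact: (@cts_fun _ _ (f : continuousType K R)). Qed.

Fact cspace0_cts : continuous (fun _ : K => 0 : R).
Proof. by move=> t; exact: cvg_cst. Qed.
Fact cspaceN_cts (f : CK) : continuous (fun t => - f t).
Proof. by move=> t; apply: cvgN; exact: cspace_cts. Qed.
Fact cspaceD_cts (f g : CK) : continuous (fun t => f t + g t).
Proof. by move=> t; apply: cvgD; exact: cspace_cts. Qed.
Fact cspaceM_cts (f g : CK) : continuous (fun t => f t * g t).
Proof. by move=> t; apply: cvgM; exact: cspace_cts. Qed.
Fact cspaceZ_cts (k : R) (f : CK) : continuous (fun t => k * f t).
Proof. by move=> t; apply: cvgMr; exact: cspace_cts. Qed.
Fact cspace_min_cts (f g : CK) : continuous (fun t => Num.min (f t) (g t)).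
Proof. by move=> t; apply: continuous_min; exact: cspace_cts. Qed.
Fact cspace_max_cts (f g : CK) : continuous (fun t => Num.max (f t) (g t)).
Proof. by move=> t; apply: continuous_max; exact: cspace_cts. Qed.

Let zero : CK := mkcspace cspace0_cts.
Let opp (f : CK) : CK := mkcspace (@cspaceN_cts f).
Let add (f g : CK) : CK := mkcspace (@cspaceD_cts f g).
Let mul (f g : CK) : CK := mkcspace (@cspaceM_cts f g).
Let scale (k : R) (f : CK) : CK := mkcspace (@cspaceZ_cts k f).
Let meet (f g : CK) : CK := mkcspace (@cspace_min_cts f g).
Let join (f g : CK) : CK := mkcspace (@cspace_max_cts f g).
Let le (f g : CK) : bool := `[< forall t, f t <= g t >].

Fact cspace_addA : associative add.
Proof. by move=> f g h; apply: cspaceP => t; exact: addrA. Qed.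
Fact cspace_addC : commutative add.
Proof. by move=> f g; apply: cspaceP => t; exact: addrC. Qed.
Fact cspace_add0 : left_id zero add.
Proof. by move=> f; apply: cspaceP => t; exact: add0r. Qed.
Fact cspace_addN : left_inverse zero opp add.
Proof. by move=> f; apply: cspaceP => t; exact: addNr. Qed.

HB.instance Definition _ := GRing.isZmodule.Build CK
  cspace_addA cspace_addC cspace_add0 cspace_addN.

Fact cspace_scaleA a b f : scale a (scale b f) = scale (a * b) f.
Proof. by apply: cspaceP => t; exact: mulrA. Qed.
Fact cspace_scale1 : left_id 1 scale.
Proof. by move=> f; apply: cspaceP => t; exact: mul1r. Qed.
Fact cspace_scaleDr : right_distributive scale +%R.
Proof. by move=> a f g; apply: cspaceP => t; exact: mulrDr. Qed.
Fact cspace_scaleDl f : {morph scale^~ f : a b / a + b}.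
Proof. by move=> a b; apply: cspaceP => t; exact: mulrDl. Qed.

HB.instance Definition _ := GRing.Zmodule_isLmodule.Build R CK
  cspace_scaleA cspace_scale1 cspace_scaleDr cspace_scaleDl.

(* [sup set0 = 0], so for empty [K] this is the norm of the zero space. *)
Definition cspace_norm (f : CK) : R := sup (range (fun t => `|f t|)).

Fact cspace_bounded (f : CK) : has_ubound (range (fun t => `|f t|)).
Proof.
have : compact (range (fun t => `|f t|)).
  apply: continuous_compact; last exact: compactT.
  by apply: continuous_subspaceT => t; apply: cvg_norm; exact: cspace_cts.
move=> /compact_bounded[M [_ fM]]; exists (M + 1) => _ [t _ <-].
have /fM/(_ `|f t|) : M < M + 1 by rewrite ltrDl.
by rewrite /= normr_id; apply; exists t.
Qed.

Fact cspace_norm_ub (f : CK) t : `|f t| <= cspace_norm f.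
Proof. by apply: ub_le_sup; [exact: cspace_bounded|exists t]. Qed.

Fact cspace_norm_le (f : CK) (M : R) :
  0 <= M -> (forall t, `|f t| <= M) -> cspace_norm f <= M.
Proof.
move=> M0 fM; rewrite /cspace_norm; set S := (X in sup X).
have [->|/set0P S0] := eqVneq S set0; first by rewrite sup0.
by apply: ge_sup => // _ [t _ <-].
Qed.

Fact cspace_norm_ge0 (f : CK) : 0 <= cspace_norm f.
Proof.
rewrite /cspace_norm; set S := (X in sup X).
have [->|/set0P [_ [t _ _]]] := eqVneq S set0; first by rewrite sup0.
exact: le_trans (cspace_norm_ub f t).
Qed.

Fact cspace_normD (f g : CK) :
  cspace_norm (f + g) <= cspace_norm f + cspace_norm g.
Proof.
apply: cspace_norm_le => [|t]; first by rewrite addr_ge0 ?cspace_norm_ge0.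
by rewrite (le_trans (ler_normD _ _))// lerD ?cspace_norm_ub.
Qed.

Fact cspace_normZ (k : R) (f : CK) :
  cspace_norm (k *: f) = `|k| * cspace_norm f.
Proof.
have le1 (a : R) (g : CK) : cspace_norm (a *: g) <= `|a| * cspace_norm g.
  apply: cspace_norm_le => [|t]; first by rewrite mulr_ge0 ?cspace_norm_ge0.
  by rewrite [_ t]/(a * g t) normrM ler_wpM2l ?cspace_norm_ub.
apply/eqP; rewrite eq_le le1 andTb.
have [->|k0] := eqVneq k 0; first by rewrite normr0 mul0r cspace_norm_ge0.
rewrite -ler_pdivlMl ?normr_gt0// -normfV.
by rewrite (le_trans _ (le1 _ _))// scalerA mulVf// scale1r.
Qed.

Fact cspace_norm0 (f : CK) : cspace_norm f = 0 -> f = 0.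
Proof.
move=> f0; apply: cspaceP => t; apply/eqP.
by rewrite -normr_le0 -f0 cspace_norm_ub.
Qed.

HB.instance Definition _ := @Lmodule_isNormed.Build R CK cspace_norm
  cspace_normD cspace_normZ cspace_norm0.

Fact cspace_complete (F : set_system CK) : ProperFilter F -> cauchy F -> cvg F.
Proof.
move=> FF /cauchy_ballP Fc.
have Fe (e : R) : 0 < e -> \forall f \near F & g \near F, forall t, `|(f : CK) t - (g : CK) t| < e.
  move=> e0; apply: filterS (Fc e e0) => -[f g] /=; rewrite -ball_normE /= => fg t.
  exact: le_lt_trans (cspace_norm_ub (f - g) t) fg.
have cvt t : cvg ((fun f : CK => f t) @ F).
  apply: cauchy_cvg; apply/cauchy_ballP => e e0; rewrite near_map2.
  by apply: filterS (Fe e e0) => -[f g] /= /(_ t).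
pose g t : R := lim ((fun f : CK => f t) @ F).
have Fg (e : R) : 0 < e -> \forall f \near F, forall t, `|(f : CK) t - g t| <= e.
  move=> e0; apply: filterS (nearP_dep (Fe e e0)) => f ff t.
  have cvd : (fun h : CK => `|f t - h t|) @ F --> `|f t - g t|.
    by apply: cvg_norm; apply: cvgB; [exact: cvg_cst|exact: cvt].
  rewrite -(cvg_lim (@Rhausdorff _) cvd); apply: limr_le.
    by apply/cvg_ex; eexists; exact: cvd.
  by apply: filterS ff => h /(_ t) /ltW.
have cg : continuous g.
  move=> t; apply/cvgrPdist_le => e e0.
  have e3 : 0 < e / 3 by rewrite divr_gt0.
  have [f ff] := filter_ex (Fg _ e3).
  have /cvgrPdist_le/(_ _ e3) := @cspace_cts f t.
  apply: filterS => s fts.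
  have -> : g t - g s = (f s - g s) + (f t - f s) - (f t - g t) by ring.
  rewrite (le_trans (ler_normB _ _))// (le_trans (lerD (ler_normD _ _) (lexx _)))//.
  by have := ff t; have := ff s; lra.
apply/cvg_ex; exists (mkcspace cg); apply/cvgrPdist_le => e e0.
apply: filterS (Fg e e0) => f fg; apply: cspace_norm_le => [|t]; first exact: ltW.
by rewrite distrC; exact: fg.
Qed.

HB.instance Definition _ := Uniform_isComplete.Build CK cspace_complete.

Fact cspace_leP (f g : CK) : reflect (forall t, f t <= g t) (le f g).
Proof. exact: asboolP. Qed.
Fact cspace_le_refl : reflexive le.
Proof. by move=> f; apply/cspace_leP. Qed.
Fact cspace_le_anti : antisymmetric le.
Proof.
move=> f g /andP[/cspace_leP fg /cspace_leP gf]; apply: cspaceP => t.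
by apply/eqP; rewrite eq_le fg gf.
Qed.
Fact cspace_le_trans : transitive le.
Proof.
move=> f g h /cspace_leP gf /cspace_leP fh; apply/cspace_leP => t.
exact: le_trans (gf t) (fh t).
Qed.
Fact cspace_le_meet f g h : le f (meet g h) = le f g && le f h.
Proof.
apply/cspace_leP/andP => [H|[/cspace_leP fg /cspace_leP fh] t].
  by split; apply/cspace_leP => t; have := H t; rewrite le_min => /andP[].
by rewrite le_min fg fh.
Qed.
Fact cspace_join_le f g h : le (join f g) h = le f h && le g h.
Proof.
apply/cspace_leP/andP => [H|[/cspace_leP fg /cspace_leP fh] t].
  by split; apply/cspace_leP => t; have := H t; rewrite ge_max => /andP[].
by rewrite ge_max fg fh.
Qed.
Fact cspace_le_add2l f g h : le g h -> le (f + g) (f + h).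
Proof. by move=> /cspace_leP gh; apply/cspace_leP => t; exact: lerD. Qed.
Fact cspace_le_scale2l (a : R) f g : 0 <= a -> le f g -> le (a *: f) (a *: g).
Proof.
by move=> a0 /cspace_leP fg; apply/cspace_leP => t; exact: ler_wpM2l.
Qed.

HB.instance Definition _ := Lmodule_isVectorLattice.Build R CK
  cspace_le_refl cspace_le_anti cspace_le_trans
  cspace_le_meet cspace_join_le cspace_le_add2l cspace_le_scale2l.

Fact cspace_lattice_norm (f g : CK) : vle (vabs f) (vabs g) -> `|f| <= `|g|.
Proof.
move=> /cspace_leP fg; apply: cspace_norm_le => [|t]; first exact: cspace_norm_ge0.
apply: le_trans (cspace_norm_ub g t).
have maxN (x : R) : Num.max x (- x) = `|x|.
  by case: (ger0P x) => x0; [rewrite max_l|rewrite max_r] => //; lra.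
by rewrite -!maxN; exact: fg.
Qed.

HB.instance Definition _ := hasLatticeNorm.Build R CK cspace_lattice_norm.

Fact cspace_mulA : associative mul.
Proof. by move=> f g h; apply: cspaceP => t; exact: mulrA. Qed.
Fact cspace_mulDl : left_distributive mul +%R.
Proof. by move=> f g h; apply: cspaceP => t; exact: mulrDl. Qed.
Fact cspace_mulDr : right_distributive mul +%R.
Proof. by move=> f g h; apply: cspaceP => t; exact: mulrDr. Qed.
Fact cspace_mulZl (k : R) f g : mul (k *: f) g = k *: mul f g.
Proof. by apply: cspaceP => t; rewrite /= -[LHS]mulrA. Qed.
Fact cspace_mulZr (k : R) f g : mul f (k *: g) = k *: mul f g.
Proof. by apply: cspaceP => t; exact: mulrCA. Qed.

HB.instance Definition _ := Lmodule_isAssocAlgebra.Build R CK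
  cspace_mulA cspace_mulDl cspace_mulDr cspace_mulZl cspace_mulZr.

Fact cspace_mul_ge0 (f g : CK) : vle 0 f -> vle 0 g -> vle 0 (f ** g).
Proof.
by move=> /cspace_leP f0 /cspace_leP g0; apply/cspace_leP => t; exact: (mulr_ge0 (f0 t) (g0 t)).
Qed.

HB.instance Definition _ := VectorLattice_isAlgebra.Build R CK cspace_mul_ge0.

Fact cspace_falg (f g h : CK) : vmeet f g = 0 -> vle 0 h ->
  vmeet (f ** h) g = 0 /\ vmeet (h ** f) g = 0.
Proof.
move=> fg0 /cspace_leP h0.
have fhg : vmeet (f ** h) g = 0.
  apply: cspaceP => t; have ht : 0 <= h t := h0 t.
  have : Num.min (f t) (g t) = 0 by exact: (congr1 (fun u : CK => u t) fg0).
  move=> m0; change (Num.min (f t * h t) (g t) = 0); move: m0.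
  case: (leP (f t) (g t)) => [fg ft|gf gt].
    by rewrite ft mul0r; apply/min_idPl; rewrite -ft.
  by rewrite gt; apply/min_idPr; rewrite mulr_ge0 // -gt ltW.
split=> //; have -> // : h ** f = f ** h.
by apply: cspaceP => t; exact: mulrC.
Qed.

HB.instance Definition _ := VectorLatticeAlgebra_isFAlgebra.Build R CK cspace_falg.

Fact cspace_normM (f g : CK) : `|f ** g| <= `|f| * `|g|.
Proof.
apply: cspace_norm_le => [|t]; first by rewrite mulr_ge0.
by rewrite normrM ler_pM ?cspace_norm_ub.
Qed.

HB.instance Definition _ := hasSubmultiplicativeNorm.Build R CK cspace_normM.

End CSpace.

(* The norm copied from the library's product is the maximum, [dsum_normE]. *)
Definition dsum_infty (R : realType) (A B : banachFAlgType R) : Type :=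
  (A * B)%type.

Section DirectSum.
Variables (R : realType) (A B : banachFAlgType R).
Local Notation AB := (dsum_infty A B).

HB.instance Definition _ := NormedModule.copy AB (A * B)%type.

Fact dsum_normE (x : AB) : `|x| = Num.max `|x.1| `|x.2|.
Proof. exact: prod_normE. Qed.

Fact dsum_complete (F : set_system AB) : ProperFilter F -> cauchy F -> cvg F.
Proof.
move=> FF /cauchy_ballP Fc.
have c1 : cvg ((fun x : AB => x.1) @ F).
  apply: cauchy_cvg; apply/cauchy_ballP => e e0; rewrite near_map2.
  by apply: filterS (Fc e e0) => -[x y] [].
have c2 : cvg ((fun x : AB => x.2) @ F).
  apply: cauchy_cvg; apply/cauchy_ballP => e e0; rewrite near_map2.
  by apply: filterS (Fc e e0) => -[x y] [].
apply/cvg_ex; exists (lim ((fun x : AB => x.1) @ F), lim ((fun x : AB => x.2) @ F)).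
apply/cvgrPdist_le => e e0.
have /cvgrPdist_le/(_ _ e0) F1 := c1.
have /cvgrPdist_le/(_ _ e0) F2 := c2.
apply: filterS2 F1 F2 => x x1 x2.
by rewrite dsum_normE ge_max x1 x2.
Qed.

HB.instance Definition _ := Uniform_isComplete.Build AB dsum_complete.

Let le (x y : AB) : bool := vle x.1 y.1 && vle x.2 y.2.
Let meet (x y : AB) : AB := (vmeet x.1 y.1, vmeet x.2 y.2).
Let join (x y : AB) : AB := (vjoin x.1 y.1, vjoin x.2 y.2).
Let mul (x y : AB) : AB := (x.1 ** y.1, x.2 ** y.2).

Fact dsum_le_refl : reflexive le.
Proof. by move=> x; rewrite /le !vle_refl. Qed.
Fact dsum_le_anti : antisymmetric le.
Proof.
move=> [x1 x2] [y1 y2] /andP[/andP[/= xy1 xy2] /andP[/= yx1 yx2]].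
by congr pair; apply: vle_anti; [rewrite xy1|rewrite xy2].
Qed.
Fact dsum_le_trans : transitive le.
Proof.
move=> y x z /andP[xy1 xy2] /andP[yz1 yz2].
by rewrite /le (vle_trans _ _ _ xy1 yz1) (vle_trans _ _ _ xy2 yz2).
Qed.
Fact dsum_le_meet x y z : le x (meet y z) = le x y && le x z.
Proof. by rewrite /le !vle_meet andbACA. Qed.
Fact dsum_join_le x y z : le (join x y) z = le x z && le y z.
Proof. by rewrite /le !vjoin_le andbACA. Qed.
Fact dsum_le_add2l x y z : le y z -> le (x + y) (x + z).
Proof. by move=> /andP[yz1 yz2]; rewrite /le !vle_add2l. Qed.
Fact dsum_le_scale2l (a : R) x y : 0 <= a -> le x y -> le (a *: x) (a *: y).
Proof. by move=> a0 /andP[xy1 xy2]; rewrite /le !vle_scale2l. Qed.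

HB.instance Definition _ := Lmodule_isVectorLattice.Build R AB
  dsum_le_refl dsum_le_anti dsum_le_trans
  dsum_le_meet dsum_join_le dsum_le_add2l dsum_le_scale2l.

Fact dsum_lattice_norm (x y : AB) : vle (vabs x) (vabs y) -> `|x| <= `|y|.
Proof.
move=> /andP[xy1 xy2]; rewrite !dsum_normE ge_max !le_max.
by rewrite (lattice_norm _ _ xy1) (lattice_norm _ _ xy2) orbT.
Qed.

HB.instance Definition _ := hasLatticeNorm.Build R AB dsum_lattice_norm.

Fact dsum_mulA : associative mul.
Proof. by move=> x y z; rewrite /mul/= !amulA. Qed.
Fact dsum_mulDl : left_distributive mul +%R.
Proof. by move=> x y z; rewrite /mul/= !amulDl. Qed.
Fact dsum_mulDr : right_distributive mul +%R.
Proof. by move=> x y z; rewrite /mul/= !amulDr. Qed.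
Fact dsum_mulZl (k : R) x y : mul (k *: x) y = k *: mul x y.
Proof. by rewrite /mul/= !amulZl. Qed.
Fact dsum_mulZr (k : R) x y : mul x (k *: y) = k *: mul x y.
Proof. by rewrite /mul/= !amulZr. Qed.

HB.instance Definition _ := Lmodule_isAssocAlgebra.Build R AB
  dsum_mulA dsum_mulDl dsum_mulDr dsum_mulZl dsum_mulZr.

Fact dsum_mul_ge0 (x y : AB) : vle 0 x -> vle 0 y -> vle 0 (x ** y).
Proof.
by move=> /andP[x1 x2] /andP[y1 y2]; apply/andP; split; exact: amul_ge0.
Qed.

HB.instance Definition _ := VectorLattice_isAlgebra.Build R AB dsum_mul_ge0.

Fact dsum_falg (x y z : AB) : vmeet x y = 0 -> vle 0 z ->
  vmeet (x ** z) y = 0 /\ vmeet (z ** x) y = 0.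
Proof.
move=> xy0 /andP[z1 z2].
have [xz1 zx1] := falg_disjoint _ _ _ (congr1 fst xy0 : vmeet x.1 y.1 = 0) z1.
have [xz2 zx2] := falg_disjoint _ _ _ (congr1 snd xy0 : vmeet x.2 y.2 = 0) z2.
by split; congr pair.
Qed.

HB.instance Definition _ := VectorLatticeAlgebra_isFAlgebra.Build R AB dsum_falg.

Fact dsum_normM (x y : AB) : `|x ** y| <= `|x| * `|y|.
Proof.
rewrite [X in X <= _]dsum_normE ge_max.
by apply/andP; split; apply: (le_trans (normr_amul _ _));
  rewrite ler_pM// dsum_normE le_max lexx ?orbT.
Qed.

HB.instance Definition _ := hasSubmultiplicativeNorm.Build R AB dsum_normM.

End DirectSum.

(* Main.v *)
From HB Require Import structures.
From mathcomp Require Import all_boot all_order all_algebra lra.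
From mathcomp Require Import all_classical all_reals all_analysis.
Require Import Defs.

Import Order.TTheory GRing.Theory Num.Theory.
Import numFieldNormedType.Exports.

(** Write J for the disjoint complement of the square-zero elements of [A].
The embedding sends [a] to its coset modulo J and to its Gelfand transform on
the space of characters of [A]. It preserves all the structure because J is a
closed order ideal that contains every product, so that the quotient Banach
lattice receives [A] with the zero product. It is injective because an element
killed by all characters has [vabs a ** vabs a = 0], and if it is in J as well
it is disjoint from itself.

Everything rests on a fact about positive orthomorphisms p of a Banach lattice:
if the norm of p is less than 1, then p x is at most x for every positive x
([ortho_strict_contraction_le]). Applied to multiplications it gives
[vabs (b ** x) <= `|b| * vabs x] ([vabs_amul_le_norm]), so that multiplications
preserve all order ideals.

That J contains the products follows from the disjointness of the kernel and
the range of an orthomorphism ([ortho_ker_disjoint]): a positive y with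
[y ** y = 0] is in the kernel of right multiplication by y, so each [b ** y] is
disjoint from y; being dominated by a multiple of y it is zero. So y is in the
kernel of every left multiplication by a positive element, hence disjoint from
all products.

For the characters, let [e = vabs a] with [e ** e <> 0]. Choose an order ideal M
maximal among those that do not contain e and modulo which [e ** e] is at least
a positive multiple of e. Such an ideal is prime, and by completeness of the
reals every element dominated by a multiple of e is congruent modulo M to a
unique real multiple of e ([maximal_standard_part]). As each [b ** e] is
dominated by [`|b|] times e, this defines phi by [b ** e = phi b * e] modulo M;
phi is a character because multiplication by b preserves M and right
multiplication by e is a lattice homomorphism ([maximal_character]). By the
choice of M, [phi e > 0], whence [phi a <> 0]. The characters bounded by the
norm form a closed subset of a product of compact intervals, and this is the
compact space K. *)

Set Implicit Arguments.
Unset Strict Implicit.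
Unset Printing Implicit Defensive.

Local Open Scope classical_set_scope.
Local Open Scope ring_scope.

(** * Vector lattices *)

Section VectorLattice.
Variables (R : realType) (V : vectorLatticeType R).
Implicit Types (x y z u v : V) (a : R).

Definition ppart x : V := vjoin x 0.

Lemma vleD2r x y z : vle (x + z) (y + z) = vle x y.
Proof.
apply/idP/idP => [/(vle_add2l (- z))|/(vle_add2l z)].
  by rewrite ![- z + _]addrC !addrK.
by rewrite ![z + _]addrC.
Qed.

Lemma vleD2l z x y : vle (z + x) (z + y) = vle x y.
Proof. by rewrite ![z + _]addrC vleD2r. Qed.

Lemma vsub_ge0 x y : vle 0 (y - x) = vle x y.
Proof. by rewrite -(vleD2r 0 _ x) add0r subrK. Qed.

Lemma vle_subl x y z : vle (x - y) z = vle x (z + y).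
Proof. by rewrite -(vleD2r (x - y) _ y) subrK. Qed.

Lemma vle_subr x y z : vle x (y - z) = vle (x + z) y.
Proof. by rewrite -(vleD2r x _ z) subrK. Qed.

Lemma vleD x y u v : vle x y -> vle u v -> vle (x + u) (y + v).
Proof.
by move=> xy uv; apply: (vle_trans (y + u)); rewrite ?vleD2r ?vleD2l.
Qed.

Lemma vaddr_ge0 x y : vle 0 x -> vle 0 y -> vle 0 (x + y).
Proof. by move=> x0 y0; rewrite -[X in vle X _](addr0 0) vleD. Qed.

Lemma vleN2 x y : vle (- x) (- y) = vle y x.
Proof. by rewrite -vsub_ge0 opprK addrC vsub_ge0. Qed.

Lemma voppr_le0 x : vle (- x) 0 = vle 0 x.
Proof. by rewrite -[X in vle _ X = _]oppr0 vleN2. Qed.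

Lemma vle_addl x y : vle 0 y -> vle x (x + y).
Proof. by move=> y0; rewrite -[X in vle X _](addr0 x) vleD2l. Qed.

Lemma vle_addr x y : vle 0 y -> vle x (y + x).
Proof. by rewrite addrC; exact: vle_addl. Qed.

Lemma vle_eqP x y : vle x y -> vle y x -> x = y.
Proof. by move=> xy yx; apply: vle_anti; rewrite xy. Qed.

Lemma vscaler_ge0 a x : 0 <= a -> vle 0 x -> vle 0 (a *: x).
Proof. by move=> a0 x0; rewrite -(scaler0 _ a) vle_scale2l. Qed.

Lemma vle_pscale2l a x y : 0 < a -> vle (a *: x) (a *: y) = vle x y.
Proof.
move=> a0; apply/idP/idP; last by apply: vle_scale2l; exact: ltW.
move=> /(vle_scale2l a^-1); rewrite invr_ge0 (ltW a0) !scalerA mulVf ?gt_eqF//.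
by rewrite !scale1r; exact.
Qed.

Lemma vjoin_ub x y : vle x (vjoin x y) /\ vle y (vjoin x y).
Proof. by apply/andP; rewrite -vjoin_le vle_refl. Qed.

Lemma vmeet_lb x y : vle (vmeet x y) x /\ vle (vmeet x y) y.
Proof. by apply/andP; rewrite -vle_meet vle_refl. Qed.

Lemma vmeetC x y : vmeet x y = vmeet y x.
Proof. exact: (@meetC _ (vlattice V)). Qed.

Lemma vjoinC x y : vjoin x y = vjoin y x.
Proof. exact: (@joinC _ (vlattice V)). Qed.

Lemma ppart_le x y : vle (ppart x) y = vle x y && vle 0 y.
Proof. by rewrite /ppart vjoin_le. Qed.

Lemma ppart_ge0 x : vle 0 (ppart x).
Proof. by case: (vjoin_ub x 0). Qed.

Lemma le_ppart x : vle x (ppart x).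
Proof. by case: (vjoin_ub x 0). Qed.

Lemma vlexx x : vle x x. Proof. exact: vle_refl. Qed.

Hint Resolve ppart_ge0 le_ppart vlexx : core.

Lemma ppart_id x : vle 0 x -> ppart x = x.
Proof. by move=> x0; apply: vle_eqP; rewrite // ppart_le x0 vle_refl. Qed.

Lemma ppart_eq0 x : vle x 0 -> ppart x = 0.
Proof. by move=> x0; apply: vle_eqP; rewrite // ppart_le x0 vle_refl. Qed.

(** Join and meet are translates of the positive part, so that every statement
about the lattice operations reduces to one about [ppart]. *)
Lemma vjoinE x y : vjoin x y = y + ppart (x - y).
Proof.
apply: vle_eqP.
  by rewrite vjoin_le vle_addl// andbT addrC -vle_subl le_ppart.
rewrite addrC -vle_subr ppart_le vleD2r vle_subr add0r.
by have [-> ->] := vjoin_ub x y.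
Qed.

Lemma vmeetE x y : vmeet x y = x - ppart (x - y).
Proof.
apply: vle_eqP.
  rewrite vle_subr addrC -vle_subr ppart_le vleD2l vleN2 vsub_ge0.
  by have [-> ->] := vmeet_lb x y.
by rewrite vle_meet !vle_subl vle_addl//= addrC -vle_subl addrC le_ppart.
Qed.

Lemma ppartN x : ppart x = x + ppart (- x).
Proof. by rewrite {1}/ppart vjoinC vjoinE sub0r. Qed.

Lemma ppart_sub x : ppart x - ppart (- x) = x.
Proof. by rewrite ppartN addrK. Qed.

Lemma ppartZ a x : 0 <= a -> ppart (a *: x) = a *: ppart x.
Proof.
rewrite le_eqVlt => /orP[/eqP<-|a0]; first by rewrite !scale0r ppart_id.
apply: vle_eqP.
  by rewrite ppart_le vscaler_ge0 ?ppart_ge0 ?ltW// vle_pscale2l// le_ppart.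
rewrite -(@vle_pscale2l a^-1) ?invr_gt0// scalerA mulVf ?gt_eqF// scale1r.
rewrite ppart_le vscaler_ge0 ?ppart_ge0 ?invr_ge0 ?ltW// andbT.
by rewrite -(@vle_pscale2l a)// scalerA mulfV ?gt_eqF// scale1r le_ppart.
Qed.

Lemma vabsE x : vabs x = ppart x + ppart (- x).
Proof.
rewrite /vabs vjoinE opprK -mulr2n -scaler_nat ppartZ// scaler_nat mulr2n.
by rewrite {1}(ppartN x) addrA addKr addrC.
Qed.

Lemma vabs_ge0 x : vle 0 (vabs x).
Proof. by rewrite vabsE vaddr_ge0. Qed.

Lemma vabs_le x y : vle (vabs x) y = vle x y && vle (- x) y.
Proof. by rewrite /vabs vjoin_le. Qed.

Lemma le_vabs x : vle x (vabs x).
Proof. by case: (vjoin_ub x (- x)). Qed.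

Lemma vabsN x : vabs (- x) = vabs x.
Proof. by rewrite /vabs opprK vjoinC. Qed.

Lemma vabs_id x : vle 0 x -> vabs x = x.
Proof. by move=> x0; rewrite vabsE ppart_id// ppart_eq0 ?voppr_le0// addr0. Qed.

Lemma vabs0 : vabs (0 : V) = 0. Proof. exact: vabs_id. Qed.

Lemma vabs_vabs x : vabs (vabs x) = vabs x.
Proof. by rewrite vabs_id// vabs_ge0. Qed.

Lemma vabs_eq0 x : vabs x = 0 -> x = 0.
Proof.
move=> x0; apply: vle_eqP; rewrite -x0 ?le_vabs//.
by rewrite -vleN2 x0 oppr0 -x0 -vabsN le_vabs.
Qed.

Lemma vabsD x y : vle (vabs (x + y)) (vabs x + vabs y).
Proof.
rewrite vabs_le vleD ?le_vabs// opprD.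
by rewrite vleD// -vabsN le_vabs.
Qed.

Lemma vabsZ a x : vabs (a *: x) = `|a| *: vabs x.
Proof.
wlog a0 : a / 0 <= a.
  move=> H; have [/H//|a0] := leP 0 a.
  by rewrite -vabsN -scaleNr H ?normrN// oppr_ge0 ltW.
by rewrite !vabsE -scalerN !ppartZ// -scalerDr ger0_norm.
Qed.

Lemma ppart_le_vabs x : vle (ppart x) (vabs x).
Proof. by rewrite ppart_le le_vabs vabs_ge0. Qed.

Lemma ppartD x y : vle (ppart (x + y)) (ppart x + ppart y).
Proof. by rewrite ppart_le vaddr_ge0// vleD. Qed.

Lemma ppart_mono x y : vle x y -> vle (ppart x) (ppart y).
Proof. by move=> xy; rewrite ppart_le ppart_ge0 andbT (vle_trans _ _ _ xy). Qed.

(** This is why the lattice operations are compatible with congruence modulo an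
order ideal. *)
Lemma vabs_ppartB x y : vle (vabs (ppart x - ppart y)) (vabs (x - y)).
Proof.
have le1 u v : vle (ppart u - ppart v) (vabs (u - v)).
  rewrite vle_subl; have := ppartD (u - v) v.
  rewrite subrK => /vle_trans; apply.
  by rewrite vleD2r ppart_le_vabs.
by rewrite vabs_le le1 opprB -(opprB y x) vabsN le1.
Qed.

Lemma vmeet_ge0 x y : vle 0 (vmeet x y) = vle 0 x && vle 0 y.
Proof. by rewrite vle_meet. Qed.

Lemma vmeet_mono x y u v : vle x u -> vle y v -> vle (vmeet x y) (vmeet u v).
Proof.
move=> xu yv; have [x1 x2] := vmeet_lb x y.
by rewrite vle_meet (vle_trans _ _ _ x1)//= (vle_trans _ _ _ x2).
Qed.

Lemma vmeet_idl x y : vle x y -> vmeet x y = x.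
Proof. by move=> xy; rewrite vmeetE ppart_eq0 ?subr0// vle_subl add0r. Qed.

Lemma vjoin_idr x y : vle x y -> vjoin x y = y.
Proof. by move=> xy; rewrite vjoinE ppart_eq0 ?addr0// vle_subl add0r. Qed.

Lemma ppart_disjoint x : vmeet (ppart x) (ppart (- x)) = 0.
Proof. by rewrite vmeetE {2}(ppartN x) addrK subrr. Qed.

Lemma disjoint_ppart x y : vmeet x y = 0 -> ppart (x - y) = x.
Proof. by rewrite vmeetE => /eqP; rewrite subr_eq0 => /eqP. Qed.

Lemma disjoint_le x y u v : vle 0 u -> vle 0 v -> vle u x -> vle v y ->
  vmeet x y = 0 -> vmeet u v = 0.
Proof.
move=> u0 v0 ux vy xy; apply: vle_eqP; last by rewrite vmeet_ge0 u0.
by rewrite -xy vmeet_mono.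
Qed.

Lemma vmeetDl x y z : vle 0 x -> vle 0 y -> vle 0 z ->
  vle (vmeet (x + y) z) (vmeet x z + vmeet y z).
Proof.
move=> x0 y0 z0; have [] := vmeet_lb (x + y) z.
move: (vmeet (x + y) z) => w w1 w2.
rewrite -vle_subl vle_meet !vle_subl; apply/andP; split.
  rewrite addrC -vle_subl vle_meet !vle_subl [y + x]addrC w1/=.
  by rewrite (vle_trans _ _ _ w2) ?vle_addl.
by rewrite (vle_trans _ _ _ w2) ?vle_addl// vmeet_ge0 y0.
Qed.

End VectorLattice.

#[local] Hint Resolve ppart_ge0 le_ppart vlexx vabs_ge0 le_vabs : core.

(** * Banach lattices *)

Section BanachLattice.
Variables (R : realType) (V : banachLatticeType R).
Implicit Types (x y z : V).

Lemma norm_vabs x : `|vabs x| = `|x|.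
Proof. by apply/eqP; rewrite eq_le !lattice_norm// vabs_vabs. Qed.

Lemma norm_vle x y : vle 0 x -> vle x y -> `|x| <= `|y|.
Proof.
by move=> x0 xy; rewrite lattice_norm// !vabs_id// (vle_trans _ _ _ x0).
Qed.

(** The positive cone is closed; limits of inequalities are taken in this
form. *)
Lemma vle0_small x :
  (forall e : R, 0 < e -> exists2 y, vle x y & `|y| <= e) -> vle x 0.
Proof.
move=> small; have p0 : ppart x = 0.
  apply/eqP; rewrite -normr_le0; apply/ler_addgt0Pl => e /small[y xy ye].
  rewrite addr0 (le_trans _ ye)// -(norm_vabs y) norm_vle//.
  by rewrite ppart_le (vle_trans _ _ _ xy)/=.
by rewrite -p0.
Qed.

Lemma vle0_scale x y : (forall e : R, 0 < e -> vle x (e *: y)) -> vle x 0.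
Proof.
move=> H; apply: vle0_small => e e0; exists ((e / (1 + `|y|)) *: y).
  by apply: H; rewrite divr_gt0// ltr_pwDl.
rewrite normrZ ger0_norm ?divr_ge0 ?addr_ge0// ?(ltW e0)//.
by rewrite mulrAC ler_pdivrMr ?ltr_pwDl// ler_pM2l// lerDr.
Qed.

Lemma archimedean_vle0 x y : (forall n, vle (x *+ n) y) -> vle x 0.
Proof.
move=> H; have y0 : vle 0 y := H 0%N.
apply: (@vle0_scale x y) => e e0.
have en := ltW (truncnS_gt e^-1); set n := (_.+1) in en.
rewrite -(@vle_pscale2l _ _ e^-1) ?invr_gt0// scalerA mulVf ?gt_eqF// scale1r.
apply: (vle_trans (ppart x *+ n)).
  rewrite -scaler_nat (vle_trans (e^-1 *: ppart x)) ?vle_pscale2l ?invr_gt0//.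
  by rewrite -vsub_ge0 -scalerBl vscaler_ge0// subr_ge0.
by rewrite -scaler_nat -ppartZ// ppart_le scaler_nat H.
Qed.

End BanachLattice.

Section ClosedSet.
Variables (R : realType) (V : normedModType R).

Lemma closed_norm_approx (I : set V) (x : V) : closed I ->
  (forall e : R, 0 < e -> exists2 y, I y & `|x - y| < e) -> I x.
Proof.
move=> cI H; apply: cI => B /nbhs_ballP[e /= e0 eB].
have [y Iy xy] := H _ e0; exists y; split=> //; apply: eB.
by rewrite -ball_normE.
Qed.

Lemma norm_approx_closed (I : set V) :
  (forall x, (forall e : R, 0 < e -> exists2 y, I y & `|x - y| < e) -> I x) ->
  closed I.
Proof.
move=> H x cx; apply: H => e e0; have [y [Iy]] := cx _ (nbhsx_ballx x e e0).
by rewrite -ball_normE => xy; exists y.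
Qed.

End ClosedSet.

(** * Orthomorphisms *)

Section Orthomorphism.
Variables (R : realType) (V : vectorLatticeType R).
Implicit Types (x y z : V) (p q : V -> V).

(** Only positive orthomorphisms are considered: the examples are the left and
right multiplications by positive elements of an f-algebra. *)
Definition orthomorphism p :=
  [/\ {morph p : x y / x + y}, forall x, vle 0 x -> vle 0 (p x) &
      forall x y, vmeet x y = 0 -> vmeet (p x) y = 0].

Lemma disjoint_ge0 x y : vmeet x y = 0 -> vle 0 x /\ vle 0 y.
Proof. by move=> xy; apply/andP; rewrite -vmeet_ge0 xy. Qed.

Lemma ortho_id : orthomorphism id. Proof. by []. Qed.

Lemma ortho_comp p q :
  orthomorphism p -> orthomorphism q -> orthomorphism (p \o q).
Proof.
move=> [pD p0 pd] [qD q0 qd]; split=> /=.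
- by move=> x y /=; rewrite qD pD.
- by move=> x x0; apply/p0/q0.
- by move=> x y xy; apply/pd/qd.
Qed.

Lemma ortho_add p q :
  orthomorphism p -> orthomorphism q -> orthomorphism (fun x => p x + q x).
Proof.
move=> [pD p0 pd] [qD q0 qd]; split=> /=.
- by move=> x y /=; rewrite qD pD addrACA.
- by move=> x x0; rewrite vaddr_ge0 ?p0 ?q0.
- move=> x y xy; have [x0 y0] := disjoint_ge0 xy.
  apply: vle_eqP; last by rewrite vmeet_ge0 vaddr_ge0 ?p0 ?q0.
  apply: (vle_trans _ _ _ (vmeetDl _ _ _)); rewrite ?p0 ?q0//.
  by rewrite pd// qd// addr0.
Qed.

Lemma ortho_zero : orthomorphism (fun _ => 0).
Proof.
split=> [x y||x y xy]; rewrite ?addr0//.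
by have [_ y0] := disjoint_ge0 xy; rewrite vmeet_idl.
Qed.

Lemma ortho_iter p n : orthomorphism p -> orthomorphism (iter n p).
Proof.
by move=> po; elim: n => [|n IH]; [exact: ortho_id|exact: ortho_comp].
Qed.

Lemma ortho_sum_iter p n :
  orthomorphism p -> orthomorphism (fun x => \sum_(k < n) iter k p x).
Proof.
move=> po; elim: n => [|n IH].
  by under eq_fun do rewrite big_ord0; exact: ortho_zero.
under eq_fun do rewrite big_ord_recr/=.
exact: ortho_add IH (ortho_iter _ po).
Qed.

Lemma vleMn2r x y n : vle x y -> vle (x *+ n) (y *+ n).
Proof.
by move=> xy; rewrite -(scaler_nat n x) -(scaler_nat n y) vle_scale2l.
Qed.

Lemma vmeetMn_eq0 x y n : vmeet x y = 0 -> vmeet (x *+ n) y = 0.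
Proof.
move=> xy; have [x0 y0] := disjoint_ge0 xy.
suff [_ _ ->//] : orthomorphism (fun z : V => z *+ n) by [].
elim: n => [|n IH]; first exact: ortho_zero.
under eq_fun do rewrite mulrS; exact: ortho_add ortho_id IH.
Qed.

Lemma vmeetZ_eq0 (a : R) x y : 0 <= a ->
  vmeet x y = 0 -> vmeet (a *: x) y = 0.
Proof.
move=> a0 xy; have [x0 y0] := disjoint_ge0 xy.
have := vmeetMn_eq0 (Num.trunc a).+1 xy; apply: disjoint_le => //.
  exact: vscaler_ge0.
rewrite -scaler_nat -vsub_ge0 -scalerBl vscaler_ge0// subr_ge0 ltW//.
exact: truncnS_gt.
Qed.

Section Theory.
Variable p : V -> V.
Hypothesis po : orthomorphism p.

Let pD : {morph p : x y / x + y}. Proof. by case: po. Qed.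

Lemma ortho0 : p 0 = 0.
Proof. by apply: (addrI (p 0)); rewrite -pD !addr0. Qed.

Lemma orthoN x : p (- x) = - p x.
Proof. by apply: (addrI (p x)); rewrite -pD !subrr ortho0. Qed.

Lemma orthoB x y : p (x - y) = p x - p y.
Proof. by rewrite pD orthoN. Qed.

Lemma orthoMn x n : p (x *+ n) = p x *+ n.
Proof. by elim: n => [|n IH]; rewrite ?ortho0// !mulrS pD IH. Qed.

(** The images of the disjoint positive and negative parts of [x] are still
disjoint, hence they are those of [p x]. *)
Lemma ortho_ppart x : p (ppart x) = ppart (p x).
Proof.
case: po => _ _ pd; rewrite -[X in ppart (p X)](addrK (ppart (- x))) -ppartN.
rewrite orthoB disjoint_ppart//; apply/pd; rewrite vmeetC; apply/pd.
by rewrite vmeetC ppart_disjoint.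
Qed.

Lemma ortho_vmeet x y : p (vmeet x y) = vmeet (p x) (p y).
Proof. by rewrite !vmeetE orthoB ortho_ppart orthoB. Qed.

Lemma ortho_vjoin x y : p (vjoin x y) = vjoin (p x) (p y).
Proof. by rewrite !vjoinE pD ortho_ppart orthoB. Qed.

End Theory.
End Orthomorphism.

Section BanachOrthomorphism.
Variables (R : realType) (V : banachLatticeType R).
Implicit Types (x y z : V).
Variable p : V -> V.
Hypothesis po : orthomorphism p.

(** Split [y] as [ppart (y - n x)] plus the meet of [y] and [n x]. The second
summand is killed by [p] and the first is disjoint from [ppart (n x - y)],
hence so is [p y]. An element [w] below both [x] and [p y] therefore satisfies
[n w <= y] for all [n]. *)
Lemma ortho_ker_disjoint x y :
  vle 0 x -> p x = 0 -> vle 0 y -> vmeet (p y) x = 0.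
Proof.
move=> x0 px0 y0; have [pD p0 pd] := po.
set w := vmeet (p y) x; have [wpy wx] : vle w (p y) /\ vle w x := vmeet_lb _ _.
have w0 : vle 0 w by rewrite vmeet_ge0 p0.
apply: vle_eqP => //; apply: (@archimedean_vle0 _ _ _ y) => n.
have pyE : p y = p (ppart (y - x *+ n)).
  have -> : ppart (y - x *+ n) = y - vmeet y (x *+ n) by rewrite vmeetE subKr.
  rewrite (orthoB po) (ortho_vmeet po) (orthoMn po) px0 mul0rn.
  by rewrite vmeetC vmeet_idl ?subr0// p0.
have dis : vmeet (p y) (ppart (w *+ n - y)) = 0.
  apply: (@disjoint_le _ _ (p y) (ppart (x *+ n - y))) => //; first exact: p0.
    by rewrite ppart_mono// vleD2r vleMn2r.
  by rewrite pyE; apply: pd; rewrite -(opprB y) ppart_disjoint.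
have wn : vle (ppart (w *+ n - y)) (p y *+ n).
  rewrite ppart_le -[X in _ && vle _ X]scaler_nat vscaler_ge0 ?p0// andbT.
  by rewrite vle_subl (vle_trans (p y *+ n)) ?vleMn2r// vle_addl.
(* [ppart (w *+ n - y)] is disjoint from [p y *+ n] and below it. *)
have t0 : ppart (w *+ n - y) = 0.
  rewrite -[LHS](vmeet_idl (vlexx _)).
  exact: disjoint_le wn (vlexx _) (vmeetMn_eq0 n dis).
by rewrite -[y]add0r -vle_subl -t0 le_ppart.
Qed.

(** Put [u = x - p x], and let S be the sum of the first [n] iterates of [p].
This is again an orthomorphism, so it commutes with taking negative parts; on
positive elements it dominates the identity; and S u telescopes to
[x - iter n p x]. So the negative part of [u] is at most that of S u, hence at
most [iter n p x], which tends to [0]. *)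
Lemma ortho_strict_contraction_le (k : R) x : 0 <= k -> k < 1 ->
  (forall y, `|p y| <= k * `|y|) -> vle 0 x -> vle (p x) x.
Proof.
move=> k0 k1 pk x0; have [pD p0 pd] := po.
set S := fun n y => \sum_(i < n) iter i p y.
have So n : orthomorphism (S n) := ortho_sum_iter n po.
have SE n : S n (x - p x) = x - iter n p x.
  elim: n => [|n IH]; first by rewrite /S big_ord0 subrr.
  rewrite /S big_ord_recr/= -/(S n _) IH (orthoB (ortho_iter n po)).
  by rewrite -iterSr addrA subrK.
have iter0 n y : vle 0 y -> vle 0 (iter n p y).
  by case: (ortho_iter n po) => _ + _; apply.
have leS n y : vle 0 y -> vle y (S n.+1 y).
  move=> y0; rewrite /S big_ord_recl/= vle_addl//.
  by elim/big_ind : _ => [||i _]; [by []|exact: vaddr_ge0|exact/p0/iter0].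
have bound n : vle (p x - x) (iter n.+1 p x).
  rewrite -opprB (vle_trans (ppart (- (x - p x))))//.
  rewrite (vle_trans _ _ _ (leS n _ _))//.
  rewrite (ortho_ppart (So _)) (orthoN (So _)) SE.
  by rewrite ppart_le opprB vle_subl vle_addl// andTb (iter0 n.+1).
have iterk n y : `|iter n p y| <= k ^+ n * `|y|.
  elim: n => [|n IH]; first by rewrite mul1r.
  by rewrite iterS (le_trans (pk _))// exprS -mulrA ler_wpM2l.
rewrite -[X in vle _ X]add0r -vle_subl; apply: vle0_small => e e0.
have : (fun n => k ^+ n * `|x|) @ \oo --> (0 : R).
  rewrite -(mul0r `|x|); apply: cvgMl; apply: cvg_expr.
  by rewrite ger0_norm.
move=> /cvgrPdist_le/(_ _ e0)[N _ /(_ N.+1)]/=.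
rewrite sub0r normrN ger0_norm ?mulr_ge0 ?exprn_ge0//.
move=> /(_ (leqnSn _)) xe; exists (iter N.+1 p x); first exact: bound.
exact: le_trans (iterk _ _) xe.
Qed.

End BanachOrthomorphism.

(** * Order ideals *)

Section Ideals.
Variables (R : realType) (V : vectorLatticeType R).
Implicit Types (x y u v : V).

Definition order_ideal (I : set V) :=
  [/\ I 0, forall x y, I x -> I y -> I (x + y),
      forall (a : R) x, I x -> I (a *: x) &
      forall x y, vle (vabs x) (vabs y) -> I y -> I x].

Section Theory.
Variable I : set V.
Hypothesis oI : order_ideal I.

Lemma ideal0 : I 0. Proof. by case: oI. Qed.

Lemma idealD x y : I x -> I y -> I (x + y).
Proof. by case: oI => _ + _ _; apply. Qed.

Lemma idealZ (a : R) x : I x -> I (a *: x).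
Proof. by case: oI => _ _ + _; apply. Qed.

Lemma ideal_solid x y : vle (vabs x) (vabs y) -> I y -> I x.
Proof. by case: oI => _ _ _; apply. Qed.

Lemma idealN x : I x -> I (- x).
Proof. by rewrite -scaleN1r; exact: idealZ. Qed.

Lemma idealB x y : I x -> I y -> I (x - y).
Proof. by move=> Ix /idealN; exact: idealD. Qed.

Lemma ideal_vabs x : I x -> I (vabs x).
Proof. by apply: ideal_solid; rewrite vabs_vabs. Qed.

Lemma ideal_between x y : vle 0 x -> vle x y -> I y -> I x.
Proof.
by move=> x0 xy; apply: ideal_solid; rewrite !vabs_id// (vle_trans _ _ _ x0).
Qed.

Lemma ideal_ppartB x y : I (x - y) -> I (ppart x - ppart y).
Proof. by apply: ideal_solid; exact: vabs_ppartB. Qed.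

Let vsubACA x y z t : (x - y) - (z - t) = (x - z) - (y - t).
Proof. by rewrite !opprD addrACA. Qed.

Lemma ideal_ppart2B x y u v :
  I (x - u) -> I (y - v) -> I (ppart (x - y) - ppart (u - v)).
Proof.
by move=> xu yv; apply: ideal_ppartB; rewrite vsubACA; exact: idealB.
Qed.

Lemma ideal_vmeetB x y u v :
  I (x - u) -> I (y - v) -> I (vmeet x y - vmeet u v).
Proof.
by move=> xu yv; rewrite !vmeetE vsubACA; apply: idealB (ideal_ppart2B xu yv).
Qed.

Lemma ideal_vjoinB x y u v :
  I (x - u) -> I (y - v) -> I (vjoin x y - vjoin u v).
Proof.
move=> xu yv; rewrite !vjoinE opprD addrACA.
exact: idealD (ideal_ppart2B xu yv).
Qed.

End Theory.
End Ideals.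

(** * Multiplication in a Banach f-algebra *)

Section FAlgebra.
Variables (R : realType) (A : fAlgType R).
Implicit Types (a b c x y : A).

Lemma ortho_amull c : vle 0 c -> orthomorphism (amul c).
Proof.
move=> c0; split=> [x y|x x0|x y xy]; first exact: amulDr.
  exact: amul_ge0.
by have [] := falg_disjoint _ _ _ xy c0.
Qed.

Lemma ortho_amulr c : vle 0 c -> orthomorphism (amul^~ c).
Proof.
move=> c0; split=> [x y|x x0|x y xy]; first exact: amulDl.
  exact: amul_ge0.
by have [] := falg_disjoint _ _ _ xy c0.
Qed.

Lemma amulNl x y : (- x) ** y = - (x ** y).
Proof. by rewrite -scaleN1r amulZl scaleN1r. Qed.

Lemma amulBl x y z : (x - y : A) ** z = x ** z - y ** z.
Proof. by rewrite amulDl amulNl. Qed.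

Lemma amulBr x y z : (x : A) ** (y - z) = x ** y - x ** z.
Proof. by rewrite amulDr -scaleN1r amulZr scaleN1r. Qed.

Lemma vabs_amul x y : vle (vabs (x ** y)) (vabs x ** vabs y).
Proof.
have pos c z : vle 0 c -> vabs (c ** z) = c ** vabs z.
  move=> /ortho_amull co; have [coD _ _] := co.
  by rewrite !vabsE coD (ortho_ppart co) (ortho_ppart co) (orthoN co).
rewrite -{1}(addrK (ppart (- x)) x) -ppartN amulBl.
rewrite (vle_trans _ _ _ (vabsD _ _))// vabsN !pos//.
by rewrite -amulDl -vabsE.
Qed.

End FAlgebra.

Section BanachFAlgebra.
Variables (R : realType) (A : banachFAlgType R).
Implicit Types (b c x y : A).

(** [ortho_strict_contraction_le] applies to multiplication by [b] divided by
any number larger than the norm of [b]. *)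
Lemma amul_le_norm b x : vle 0 b -> vle 0 x -> vle (b ** x) (`|b| *: x).
Proof.
move=> b0 x0; rewrite -[X in vle _ X]add0r -vle_subl.
apply: (@vle0_scale _ _ _ x) => e e0.
rewrite vle_subl -scalerDl; set t := e + `|b|.
have t0 : 0 < t by rewrite ltr_wpDr.
rewrite -(@vle_pscale2l _ _ t^-1) ?invr_gt0// scalerA mulVf ?gt_eqF// scale1r.
rewrite -amulZl.
apply: (@ortho_strict_contraction_le _ _ _ _ (`|b| / t)) => //.
- by apply: ortho_amull; rewrite vscaler_ge0// invr_ge0 ltW.
- by rewrite divr_ge0// ltW.
- by rewrite ltr_pdivrMr// mul1r ltrDr.
- move=> y; rewrite (le_trans (normr_amul _ _))// normrZ.
  by rewrite ger0_norm ?invr_ge0 ?(ltW t0)// [t^-1 * _]mulrC.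
Qed.

Lemma vabs_amul_le_norm b x : vle (vabs (b ** x)) (`|b| *: vabs x).
Proof.
rewrite (vle_trans _ _ _ (vabs_amul _ _))//.
by rewrite -(norm_vabs b) amul_le_norm.
Qed.

(** By [ortho_ker_disjoint], [b ** x] is disjoint from [x]; being also
dominated by a multiple of [x], it vanishes. *)
Lemma nilpotent_annihilates b x :
  vle 0 b -> vle 0 x -> x ** x = 0 -> b ** x = 0.
Proof.
move=> b0 x0 xx.
have := ortho_ker_disjoint (ortho_amulr x0) x0 xx b0.
rewrite vmeetC => /(vmeetZ_eq0 (normr_ge0 b)); rewrite vmeetC.
by rewrite vmeet_idl// amul_le_norm.
Qed.

(** The band complementary to the nilpotent elements, which in an Archimedean
f-algebra are those of square zero. *)
Definition nilpotent_disjoint : set A :=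
  [set x | forall y, vle 0 y -> y ** y = 0 -> vmeet (vabs x) y = 0].

(** A positive [y] of square zero is in the kernel of left multiplication by
[vabs b], and so disjoint from its range. *)
Lemma nilpotent_disjoint_amul b c : nilpotent_disjoint (b ** c).
Proof.
move=> y y0 yy; have by0 := nilpotent_annihilates (vabs_ge0 b) y0 yy.
have := ortho_ker_disjoint (ortho_amull (vabs_ge0 b)) y0 by0 (vabs_ge0 c).
by apply: disjoint_le => //; exact: vabs_amul.
Qed.

Lemma nilpotent_disjoint_eq0 x :
  nilpotent_disjoint x -> vabs x ** vabs x = 0 -> x = 0.
Proof.
by move=> Jx /(Jx _ (vabs_ge0 x)); rewrite vmeet_idl//; exact: vabs_eq0.
Qed.

Lemma nilpotent_disjoint_ideal : order_ideal nilpotent_disjoint.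
Proof.
split=> [y y0 _|x y Jx Jy z z0 zz|a x Jx z z0 zz|x y xy Jy z z0 zz].
- by rewrite vabs0 vmeet_idl.
- have /eqP : vmeet (vabs x + vabs y) z = 0.
    apply: vle_eqP; last by rewrite vmeet_ge0 vaddr_ge0.
    rewrite (vle_trans _ _ _ (vmeetDl _ _ _))// Jx// Jy// addr0.
    exact: vlexx.
  by move=> /eqP; apply: disjoint_le => //; exact: vabsD.
- by rewrite vabsZ vmeetZ_eq0// Jx.
- by apply: disjoint_le (Jy z z0 zz).
Qed.

Lemma nilpotent_disjoint_closed : closed nilpotent_disjoint.
Proof.
apply: norm_approx_closed => x H y y0 yy.
apply: vle_eqP; last by rewrite vmeet_ge0 vabs_ge0.
apply: vle0_small => e /H[z Jz xz]; exists (vabs (x - z)).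
  have := vabsD (x - z) z.
  rewrite subrK => /vmeet_mono/(_ (vlexx y)) /vle_trans; apply.
  rewrite (vle_trans _ _ _ (vmeetDl _ _ _))// Jz// addr0.
  by have [] := vmeet_lb (vabs (x - z)) y.
by rewrite norm_vabs ltW.
Qed.

End BanachFAlgebra.

(** * The quotient of a Banach lattice by a closed ideal *)

Record closedIdeal (R : realType) (V : banachLatticeType R) := ClosedIdeal {
  ideal_set :> V -> Prop;
  ideal_order : order_ideal (ideal_set : set V);
  ideal_closed : closed (ideal_set : set V)
}.

Section Quotient.
Variables (R : realType) (V : banachLatticeType R) (I : closedIdeal V).
Implicit Types (x y z : V).

Definition ideal_pred : {pred V} := fun x => `[< I x >].

Let Io : order_ideal (I : set V) := ideal_order I.

Fact ideal_zmod_closed : zmod_closed ideal_pred.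
Proof.
split; first exact/asboolP/(ideal0 Io).
by move=> x y /asboolP Ix /asboolP Iy; apply/asboolP/(idealB Io).
Qed.

HB.instance Definition _ := GRing.isZmodClosed.Build V ideal_pred
  ideal_zmod_closed.

Definition quotient : Type := Quotient.quot ideal_pred.

HB.instance Definition _ := GRing.Zmodule.on quotient.

Definition coset x : quotient := (\pi_(Quotient.quot ideal_pred) x)%qT.

Lemma coset_surj (u : quotient) : exists x, u = coset x.
Proof.
by exists (repr (u : Quotient.quot ideal_pred)); rewrite /coset reprK.
Qed.

Lemma coset_eqP x y : coset x = coset y <-> I (x - y).
Proof.
split=> [/eqP|Ixy].
  by rewrite -Quotient.idealrBE => /asboolP.
by apply/eqP; rewrite -Quotient.idealrBE; exact/asboolP.
Qed.

Lemma cosetD x y : coset (x + y) = coset x + coset y.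
Proof. by rewrite /coset raddfD. Qed.

Lemma cosetB x y : coset (x - y) = coset x - coset y.
Proof. by rewrite /coset raddfB. Qed.

Lemma cosetN x : coset (- x) = - coset x.
Proof. by rewrite /coset raddfN. Qed.

Lemma coset0 : coset 0 = 0.
Proof. by rewrite /coset raddf0. Qed.

Definition coset_repr (u : quotient) : V := projT1 (cid (coset_surj u)).

Lemma coset_reprK u : coset (coset_repr u) = u.
Proof. by rewrite /coset_repr; case: cid => x /= ->. Qed.

Lemma coset_repr_ideal x : I (coset_repr (coset x) - x).
Proof. by apply/coset_eqP; rewrite coset_reprK. Qed.

Let scale (a : R) (u : quotient) := coset (a *: coset_repr u).

Let scaleE a x : scale a (coset x) = coset (a *: x).
Proof.
apply/coset_eqP; rewrite -scalerBr; exact/(idealZ Io)/coset_repr_ideal.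
Qed.

Fact quotient_scaleA a b u : scale a (scale b u) = scale (a * b) u.
Proof. by have [x ->] := coset_surj u; rewrite !scaleE scalerA. Qed.
Fact quotient_scale1 : left_id 1 scale.
Proof. by move=> u; have [x ->] := coset_surj u; rewrite !scaleE scale1r. Qed.
Fact quotient_scaleDr : right_distributive scale +%R.
Proof.
move=> a u v; have [x ->] := coset_surj u; have [y ->] := coset_surj v.
by rewrite -cosetD !scaleE scalerDr cosetD.
Qed.
Fact quotient_scaleDl u : {morph scale^~ u : a b / a + b}.
Proof.
by move=> a b; have [x ->] := coset_surj u; rewrite !scaleE scalerDl cosetD.
Qed.

HB.instance Definition _ := GRing.Zmodule_isLmodule.Build R quotient
  quotient_scaleA quotient_scale1 quotient_scaleDr quotient_scaleDl.

Lemma cosetZ (a : R) x : coset (a *: x) = a *: coset x.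
Proof. by rewrite -scaleE. Qed.

Definition quotient_norm (u : quotient) : R :=
  inf [set `|x| | x in [set x | coset x = u]].

Let norm_set_lb u : lbound [set `|x| | x in [set x | coset x = u]] 0.
Proof. by move=> _ [x _ <-]. Qed.

Let norm_set_neq0 u : [set `|x| | x in [set x | coset x = u]] !=set0.
Proof. by have [x ->] := coset_surj u; exists `|x|, x. Qed.

Lemma coset_norm_le x : quotient_norm (coset x) <= `|x|.
Proof. by apply: ge_inf; [exists 0; exact: norm_set_lb|exists x]. Qed.

Lemma quotient_norm_ge0 u : 0 <= quotient_norm u.
Proof. by apply: lb_le_inf; [exact: norm_set_neq0|exact: norm_set_lb]. Qed.

Lemma quotient_norm_lt u (r : R) :
  quotient_norm u < r -> exists2 x, u = coset x & `|x| < r.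
Proof.
by move=> /(inf_lt (norm_set_neq0 u))[_ [x <- <-] xr]; exists x.
Qed.

Fact quotient_normD u v :
  quotient_norm (u + v) <= quotient_norm u + quotient_norm v.
Proof.
apply/ler_addgt0Pr => e e0; have e2 : 0 < e / 2 by rewrite divr_gt0.
have [x xu xe] : exists2 x, u = coset x & `|x| < quotient_norm u + e / 2.
  by apply: quotient_norm_lt; rewrite ltrDl.
have [y yv ye] : exists2 y, v = coset y & `|y| < quotient_norm v + e / 2.
  by apply: quotient_norm_lt; rewrite ltrDl.
rewrite {1}xu {1}yv -cosetD (le_trans (coset_norm_le _))//.
by rewrite (le_trans (ler_normD _ _))//; lra.
Qed.

Fact quotient_normZ (a : R) u :
  quotient_norm (a *: u) = `|a| * quotient_norm u.
Proof.
have le1 (b : R) v : quotient_norm (b *: v) <= `|b| * quotient_norm v.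
  have [->|b0] := eqVneq b 0.
    rewrite scale0r normr0 mul0r -coset0 (le_trans (coset_norm_le _))//.
    by rewrite normr0.
  rewrite -ler_pdivrMl ?normr_gt0//; apply/ler_addgt0Pr => e e0.
  have [x -> /ltW xe] : exists2 x, v = coset x & `|x| < quotient_norm v + e.
    by apply: quotient_norm_lt; rewrite ltrDl.
  rewrite -cosetZ ler_pdivrMl ?normr_gt0// (le_trans (coset_norm_le _))//.
  by rewrite normrZ ler_wpM2l.
apply/eqP; rewrite eq_le le1 andTb.
have [->|a0] := eqVneq a 0; first by rewrite normr0 mul0r quotient_norm_ge0.
rewrite -ler_pdivlMl ?normr_gt0// -normfV.
by rewrite (le_trans _ (le1 _ _))// scalerA mulVf// scale1r.
Qed.

Fact quotient_norm0 u : quotient_norm u = 0 -> u = 0.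
Proof.
have [x ->] := coset_surj u => x0; rewrite -coset0; apply/coset_eqP.
rewrite subr0; apply: (closed_norm_approx (@ideal_closed _ _ I)) => e e0.
have [|y /coset_eqP Ixy ye] := @quotient_norm_lt (coset x) e.
  by rewrite x0.
by exists (x - y) => //; rewrite subKr.
Qed.

HB.instance Definition _ := @Lmodule_isNormed.Build R quotient quotient_norm
  quotient_normD quotient_normZ quotient_norm0.

Lemma norm_coset_le x : `|coset x| <= `|x|.
Proof. exact: coset_norm_le. Qed.

Lemma norm_coset_lift (u : quotient) (r : R) :
  `|u| < r -> exists2 x, u = coset x & `|x| < r.
Proof. exact: quotient_norm_lt. Qed.

(** A Cauchy filter contains a ball of radius 2^-n for each n. The differences
of successive centres have summable norms, so they lift to an absolutely
convergent series, and the coset of its sum, shifted by a lift of the first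
centre, is the limit of the filter. *)
Fact quotient_complete (F : set_system quotient) :
  ProperFilter F -> cauchy F -> cvg F.
Proof.
move=> FF /cauchyP Fc; pose r n : R := 2^-1 ^+ n.
have r0 n : 0 < r n by rewrite exprn_gt0.
have /choice[c Fb] n : exists c, F (ball c (r n)) by exact: Fc.
have /choice[d] n : exists d, coset d = c n.+1 - c n /\ `|d| <= 2 * r n.
  have [u [un un1]] := filter_ex (filterI (Fb n) (Fb n.+1)).
  have cc : `|c n.+1 - c n| < 2 * r n.
    move: un un1; rewrite -!ball_normE /= => un un1.
    rewrite distrC -(subrKA u) (le_lt_trans (ler_normD _ _))//.
    rewrite [`|u - _|]distrC mulr_natl mulr2n ltrD// (lt_le_trans un1)//.
    by rewrite /r exprS ler_piMl// ?exprn_ge0// invf_le1// ler1n.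
  by have [x -> /ltW] := norm_coset_lift cc; exists x.
move=> /all_and2[dc dr].
pose a n := coset_repr (c 0%N) + series d n.
have ac n : coset (a n) = c n.
  rewrite cosetD coset_reprK; elim: n => [|n IH].
    by rewrite /series/= big_geq// coset0 addr0.
  by rewrite seriesSr cosetD addrA IH dc addrC subrK.
have /cvg_ex[l al] : cvgn (series d).
  apply: normed_cvg; apply: (@series_le_cvg _ _ (geometric 2 2^-1)) => [n|n|n|].
  - exact: normr_ge0.
  - by apply: mulr_ge0 => //; exact: ltW (r0 n).
  - exact: dr.
  apply: is_cvg_geometric_series.
  by rewrite ger0_norm// invf_lt1// ltr1n.
pose b := coset_repr (c 0%N) + l.
have rcvg : r n @[n --> \oo] --> (0 : R).
  by apply: cvg_expr; rewrite ger0_norm// invf_lt1// ltr1n.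
apply/cvg_ex; exists (coset b); apply/cvgrPdist_le => e e0.
have e2 : 0 < e / 2 by rewrite divr_gt0.
have /cvgrPdist_le/(_ _ e2) la := al.
have /cvgrPdist_le/(_ _ e2) re := rcvg.
have [n [lan ren]] := filter_ex (filterI la re).
apply: filterS (Fb n) => u; rewrite -ball_normE /= => cu.
rewrite -(subrKA (c n)) (le_trans (ler_normD _ _))// [e]splitr lerD//.
  rewrite -ac -cosetB (le_trans (norm_coset_le _))//.
  by rewrite /b /a opprD addrACA subrr add0r.
move: ren => /=; rewrite sub0r normrN ger0_norm ?(ltW (r0 n))// => ren.
by rewrite (le_trans _ ren)// ltW.
Qed.

HB.instance Definition _ := Uniform_isComplete.Build quotient quotient_complete.

Let le (u v : quotient) : bool :=
  `[< I (ppart (coset_repr u - coset_repr v)) >].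
Let meet (u v : quotient) := coset (vmeet (coset_repr u) (coset_repr v)).
Let join (u v : quotient) := coset (vjoin (coset_repr u) (coset_repr v)).

Let leE x y : le (coset x) (coset y) = `[< I (ppart (x - y)) >].
Proof.
have Ixy := ideal_ppart2B Io (coset_repr_ideal x) (coset_repr_ideal y).
apply/asboolP/asboolP => Ip.
  rewrite -[ppart (x - y)](subKr
    (ppart (coset_repr (coset x) - coset_repr (coset y)))).
  exact: idealB Io _ _ Ip Ixy.
rewrite -[X in I X](subrK (ppart (x - y))).
exact: idealD Io _ _ Ixy Ip.
Qed.

Let meetE x y : meet (coset x) (coset y) = coset (vmeet x y).
Proof. by apply/coset_eqP/(ideal_vmeetB Io); exact: coset_repr_ideal. Qed.

Let joinE x y : join (coset x) (coset y) = coset (vjoin x y).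
Proof. by apply/coset_eqP/(ideal_vjoinB Io); exact: coset_repr_ideal. Qed.

Fact quotient_le_refl : reflexive le.
Proof.
by move=> u; apply/asboolP; rewrite subrr ppart_id//; exact: ideal0 Io.
Qed.
Fact quotient_le_anti : antisymmetric le.
Proof.
move=> u v; have [x ->] := coset_surj u; have [y ->] := coset_surj v.
rewrite !leE => /andP[/asboolP xy /asboolP yx]; apply/coset_eqP.
rewrite -[x - y](addrK (ppart (- (x - y)))) -ppartN.
by apply: (idealB Io) => //; rewrite opprB.
Qed.
Fact quotient_le_trans : transitive le.
Proof.
move=> v u w; have [x ->] := coset_surj u; have [y ->] := coset_surj v.
have [z ->] := coset_surj w; rewrite !leE => /asboolP xy /asboolP yz.
apply/asboolP; apply: (ideal_between Io) (idealD Io xy yz) => //.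
by rewrite -(subrKA y) ppartD.
Qed.
Fact quotient_le_meet u v w : le u (meet v w) = le u v && le u w.
Proof.
have [x ->] := coset_surj u; have [y ->] := coset_surj v.
have [z ->] := coset_surj w; rewrite meetE !leE.
have [my mz] := vmeet_lb y z.
apply/asboolP/andP => [Im|[/asboolP xy /asboolP xz]].
  by split; apply/asboolP; apply: (ideal_between Io) Im => //;
    rewrite ppart_mono// vleD2l vleN2.
apply: (ideal_between Io) (idealD Io xy xz) => //.
rewrite ppart_le vaddr_ge0// andbT vle_subl addrC -vle_subl.
rewrite vle_meet !vle_subl; apply/andP; split.
  rewrite addrC -vle_subl (vle_trans _ _ _ (le_ppart _))//.
  exact: vle_addl.
rewrite addrC -vle_subl (vle_trans _ _ _ (le_ppart _))//.
exact: vle_addr.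
Qed.
Fact quotient_join_le u v w : le (join u v) w = le u w && le v w.
Proof.
have [x ->] := coset_surj u; have [y ->] := coset_surj v.
have [z ->] := coset_surj w; rewrite joinE !leE.
have [xj yj] := vjoin_ub x y.
apply/asboolP/andP => [Im|[/asboolP xz /asboolP yz]].
  by split; apply/asboolP; apply: (ideal_between Io) Im => //;
    rewrite ppart_mono// vleD2r.
apply: (ideal_between Io) (idealD Io xz yz) => //.
rewrite ppart_le vaddr_ge0// andbT vle_subl vjoin_le; apply/andP; split.
  rewrite -vle_subl (vle_trans _ _ _ (le_ppart _))//.
  exact: vle_addl.
rewrite -vle_subl (vle_trans _ _ _ (le_ppart _))//.
exact: vle_addr.
Qed.
Fact quotient_le_add2l u v w : le v w -> le (u + v) (u + w).
Proof.
have [x ->] := coset_surj u; have [y ->] := coset_surj v.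
have [z ->] := coset_surj w; rewrite -!cosetD !leE.
by rewrite opprD addrACA subrr add0r.
Qed.
Fact quotient_le_scale2l (a : R) u v : 0 <= a -> le u v -> le (a *: u) (a *: v).
Proof.
move=> a0; have [x ->] := coset_surj u; have [y ->] := coset_surj v.
rewrite -!cosetZ !leE => /asboolP xy; apply/asboolP.
by rewrite -scalerBr ppartZ//; exact: (idealZ Io).
Qed.

HB.instance Definition _ := Lmodule_isVectorLattice.Build R quotient
  quotient_le_refl quotient_le_anti quotient_le_trans
  quotient_le_meet quotient_join_le quotient_le_add2l quotient_le_scale2l.

Lemma coset_vmeet x y : coset (vmeet x y) = vmeet (coset x) (coset y).
Proof. by rewrite -meetE. Qed.

Lemma coset_vjoin x y : coset (vjoin x y) = vjoin (coset x) (coset y).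
Proof. by rewrite -joinE. Qed.

Lemma vle_coset x y : vle (coset x) (coset y) <-> I (ppart (x - y)).
Proof. by rewrite -[vle _ _]/(le _ _) leE; split=> /asboolP. Qed.

Lemma vabs_coset x : vabs (coset x) = coset (vabs x).
Proof. by rewrite /vabs coset_vjoin cosetN. Qed.

(** If the coset of [x] is dominated in modulus by that of [y], then truncating
the positive and negative parts of [x] at [vabs y] changes [x] only by an
element of the ideal, and yields a representative of norm at most that of
[y]. *)
Fact quotient_lattice_norm (u v : quotient) :
  vle (vabs u) (vabs v) -> `|u| <= `|v|.
Proof.
have [x ->] := coset_surj u => xv; apply/ler_addgt0Pr => e e0.
have [|y vy ye] := @norm_coset_lift v (`|v| + e); first by rewrite ltrDl.
move: xv; rewrite {1}vy !vabs_coset => /vle_coset Ixy.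
pose t z := vmeet (ppart z) (vabs y).
have It z : vle z (vabs x) -> I (ppart z - t z).
  move=> zx; rewrite /t vmeetE subKr; apply: (ideal_between Io) Ixy => //.
  by rewrite ppart_mono// vleD2r ppart_le zx vabs_ge0.
have ty z : vle (t z) (vabs y) by have [] := vmeet_lb (ppart z) (vabs y).
have t0 z : vle 0 (t z) by rewrite vmeet_ge0 ppart_ge0 vabs_ge0.
have tB z w : vle (t z - t w) (vabs y).
  by rewrite (vle_trans _ _ _ _ (ty z))// vle_subl vle_addl.
have -> : coset x = coset (t x - t (- x)).
  apply/coset_eqP; rewrite -{1}[x]ppart_sub opprD addrACA -opprD.
  by apply: (idealB Io); apply: It => //; rewrite -vabsN.
rewrite (le_trans (norm_coset_le _))// (le_trans _ (ltW ye))//.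
by apply: lattice_norm; rewrite vabs_le opprB !tB.
Qed.

HB.instance Definition _ := hasLatticeNorm.Build R quotient
  quotient_lattice_norm.

End Quotient.

(** * Maximal ideals *)

Section MaximalIdeal.
Variables (R : realType) (V : vectorLatticeType R).
Implicit Types (x y u v e m : V) (I M : set V).

Lemma order_ideal_zero : order_ideal [set (0 : V)].
Proof.
split=> [|x y -> ->|a x ->|x y + y0]; rewrite /= ?addr0 ?scaler0//.
rewrite y0 vabs0 => x0; apply: vabs_eq0; exact: vle_eqP.
Qed.

Definition ideal_adjoin I u : set V :=
  [set x | exists m, I m /\ exists2 a : R, 0 <= a &
    vle (vabs x) (vabs m + a *: vabs u)].

Lemma ideal_adjoin_order I u : order_ideal I -> order_ideal (ideal_adjoin I u).
Proof.
move=> Io; split.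
- exists 0; split; first exact: ideal0 Io.
  by exists 0 => //; rewrite scale0r addr0.
- move=> x y [m [Im [a a0 xm]]] [n [In [b b0 yn]]].
  exists (vabs m + vabs n); split.
    by apply: (idealD Io); exact: ideal_vabs.
  exists (a + b); first exact: addr_ge0.
  rewrite (vle_trans _ _ _ (vabsD _ _))//.
  by rewrite (@vabs_id _ _ (vabs m + _)) ?vaddr_ge0// scalerDl addrACA vleD.
- move=> k x [m [Im [a a0 xm]]]; exists (k *: m).
  split; first exact: (idealZ Io).
  exists (`|k| * a); first exact: mulr_ge0.
  by rewrite !vabsZ -scalerA -scalerDr vle_scale2l.
- move=> x y xy [m [Im [a a0 ym]]]; exists m; split=> //; exists a => //.
  exact: vle_trans xy ym.
Qed.

Lemma ideal_adjoin_sub I u : I `<=` ideal_adjoin I u.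
Proof.
by move=> m Im; exists m; split=> //; exists 0 => //; rewrite scale0r addr0.
Qed.

Lemma ideal_adjoin_mem I u : order_ideal I -> ideal_adjoin I u u.
Proof.
move=> Io; exists 0; split; first exact: ideal0 Io.
by exists 1 => //; rewrite vabs0 add0r scale1r.
Qed.

Definition maximal_without e M := [/\ order_ideal M, ~ M e &
  forall N, order_ideal N -> M `<=` N -> ~ N e -> N `<=` M].

Lemma maximal_without_exists I e : order_ideal I -> ~ I e ->
  exists2 M, maximal_without e M & I `<=` M.
Proof.
(* Taking unions with [I] makes the empty chain bounded. *)
move=> Io Ie; pose P (X : set V) := order_ideal (X `|` I) /\ ~ (X `|` I) e.
have [F FP Ftot|M [[Mo Me] Mmax]] := @Zorn_bigcup V P.
  split; last by move=> [[X FX Xe]|//]; have [_] := FP _ FX; apply; left.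
  split.
  - by right; exact: ideal0 Io.
  - move=> x y [[X FX Xx]|Ix] [[Y FY Yy]|Iy].
    + have [XY|YX] := Ftot _ _ FX FY.
        have [Yo _] := FP _ FY.
        have [] := idealD Yo (or_introl (XY _ Xx)) (or_introl Yy);
          last by right.
        by move=> Yxy; left; exists Y.
      have [Xo _] := FP _ FX.
      have [] := idealD Xo (or_introl Xx) (or_introl (YX _ Yy)); last by right.
      by move=> Xxy; left; exists X.
    + have [Xo _] := FP _ FX.
      have [] := idealD Xo (or_introl Xx) (or_intror Iy); last by right.
      by move=> Xxy; left; exists X.
    + have [Yo _] := FP _ FY.
      have [] := idealD Yo (or_intror Ix) (or_introl Yy); last by right.
      by move=> Yxy; left; exists Y.
    + by right; exact: (idealD Io).
  - move=> a x [[X FX Xx]|Ix]; last by right; exact: (idealZ Io).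
    have [Xo _] := FP _ FX.
    have [] := idealZ Xo a (or_introl Xx); last by right.
    by move=> Xax; left; exists X.
  - move=> x y xy [[X FX Xy]|Iy]; last by right; exact: (ideal_solid Io xy).
    have [Xo _] := FP _ FX.
    have [] := ideal_solid Xo xy (or_introl Xy); last by right.
    by move=> Xx; left; exists X.
exists (M `|` I); last exact: subsetUr.
split=> // N No MIN Ne; apply: contrapT => NM.
have NI : N `|` I = N by apply: setUidl => x Ix; apply: MIN; right.
apply: (Mmax N); last by rewrite /P NI.
split; first by move=> x Mx; apply: MIN; left.
by move=> NM'; apply: NM => x /NM' Mx; left.
Qed.

Section Theory.
Variables (e : V) (M : set V).
Hypotheses (e0 : vle 0 e) (maxM : maximal_without e M).

Let Mo : order_ideal M. Proof. by case: maxM. Qed.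
Let Me : ~ M e. Proof. by case: maxM. Qed.

Lemma maximal_le0 (a : R) m : M m -> vle (a *: e) m -> a <= 0.
Proof.
move=> Mm aem; rewrite leNgt; apply/negP => a0; apply: Me.
have : M (a *: e).
  by apply: (ideal_between Mo) Mm => //; exact: vscaler_ge0 (ltW a0) e0.
by move=> /(idealZ Mo a^-1); rewrite scalerA mulVf ?gt_eqF// scale1r.
Qed.

Lemma maximal_adjoin u : vle 0 u -> ~ M u ->
  exists m, M m /\ exists2 a : R, 0 < a & vle (a *: e) (m + u).
Proof.
move=> u0 Mu; have [m [Mm [a a0]]] : ideal_adjoin M u e.
  apply: contrapT => Ne; case: maxM => _ _ /(_ _ (ideal_adjoin_order u Mo)).
  move=> /(_ (@ideal_adjoin_sub _ _) Ne) /(_ u (ideal_adjoin_mem u Mo)).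
  exact: Mu.
rewrite (vabs_id e0) (vabs_id u0) => ema.
have a1 : 0 < a + 1 by rewrite ltr_wpDl.
exists ((a + 1)^-1 *: vabs m); split; first exact/(idealZ Mo)/(ideal_vabs Mo).
exists (a + 1)^-1; first by rewrite invr_gt0.
rewrite -(@vle_pscale2l _ _ (a + 1))// scalerDr !scalerA mulfV ?gt_eqF//.
rewrite !scale1r.
by rewrite (vle_trans _ _ _ ema)// vleD2l scalerDl scale1r vle_addl.
Qed.

(** If neither of two disjoint elements is in [M], then [e] is dominated
modulo [M] by multiples of both, hence by [0]. *)
Lemma maximal_prime u v : vmeet u v = 0 -> M u \/ M v.
Proof.
move=> uv; have [u0 v0] := disjoint_ge0 uv.
have [|Mu] := pselect (M u); first by left.
have [|Mv] := pselect (M v); first by right.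
have [m [Mm [a a0 au]]] := maximal_adjoin u0 Mu.
have [n [Mn [b b0 bv]]] := maximal_adjoin v0 Mv.
have lemin (c k : R) x y : vle (c *: e) (x + y) -> 0 <= k -> k <= c ->
    vle (k *: e - vabs x) y.
  move=> cxy k0 kc; rewrite vle_subl; apply: (vle_trans (c *: e)).
    by rewrite -vsub_ge0 -scalerBl vscaler_ge0// subr_ge0.
  by apply: (vle_trans _ _ _ cxy); rewrite addrC vleD2l.
pose k := Num.min a b; have k0 : 0 < k by rewrite lt_min a0.
have : vle (k *: e - (vabs m + vabs n)) (vmeet u v).
  rewrite vle_meet opprD addrA; apply/andP; split.
    rewrite vle_subl (vle_trans u) ?vle_addl//.
    by apply: lemin au (ltW k0) _; rewrite ge_min lexx.
  rewrite addrAC vle_subl (vle_trans v) ?vle_addl//.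
  by apply: lemin bv (ltW k0) _; rewrite ge_min lexx orbT.
rewrite uv vle_subl add0r => /(maximal_le0 (idealD Mo _ _)).
by rewrite leNgt k0 => /(_ (ideal_vabs Mo Mm) (ideal_vabs Mo Mn)).
Qed.

(** The real [l] is the supremum of those [t] for which [t *: e] is below [x]
modulo [M]. By primality the positive or the negative part of [x - l *: e] is
in [M]. If the other one were not, it would dominate a positive multiple of [e]
modulo [M] by maximality, so that [l] could be raised or lowered. *)
Lemma maximal_standard_part (C : R) x : vle (vabs x) (C *: e) ->
  exists l : R, M (x - l *: e).
Proof.
rewrite vabs_le => /andP[xC NxC].
pose S := [set l : R | M (ppart (l *: e - x))].
have SC : ubound S C.
  move=> l Sl; rewrite -subr_le0; apply: maximal_le0 Sl _.
  by rewrite scalerBl (vle_trans _ _ _ _ (le_ppart _))// vleD2l vleN2.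
have hS : has_sup S.
  split; last by exists C.
  exists (- C); rewrite /S/= ppart_eq0; first exact: ideal0 Mo.
  by rewrite vle_subl add0r scaleNr -(opprK x) vleN2.
pose l := sup S; exists l; set z := x - l *: e; rewrite -(ppart_sub z).
have [Mu|Mv] := maximal_prime (ppart_disjoint z).
  have [Mv|Mv] := pselect (M (ppart (- z))); first exact: (idealB Mo).
  have [m [Mm [a a0 av]]] := maximal_adjoin (ppart_ge0 _) Mv.
  have [t St tl] := sup_adherent a0 hS.
  exfalso; move: tl; rewrite ltNge => /negP; apply.
  rewrite -subr_le0; apply: (maximal_le0 (idealD Mo St (idealD Mo Mu Mm))).
  have -> : (t - (l - a)) *: e =
      (t *: e - x) + (ppart z + (a *: e - ppart (- z))).
    rewrite [ppart z + _]addrCA ppart_sub [a *: e + _]addrCA subrKA.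
    by rewrite opprB scalerDl scalerBl.
  by rewrite vleD// vleD2l vle_subl.
have [Mu|Mu] := pselect (M (ppart z)); first exact: (idealB Mo).
have [m [Mm [a a0 au]]] := maximal_adjoin (ppart_ge0 _) Mu.
have Sla : S (l + a).
  apply: (ideal_between Mo _ _ (idealD Mo (ideal_vabs Mo Mm) Mv)) => //.
  have -> : (l + a) *: e - x = (a *: e - ppart z) + ppart (- z).
    rewrite -addrA [- _ + _]addrC -(opprB (ppart z)) ppart_sub.
    by rewrite /z opprB scalerDl addrCA addrA.
  rewrite ppart_le vaddr_ge0// andbT vleD2r vle_subl.
  by rewrite (vle_trans _ _ _ au)// vleD2r.
by have := sup_ubound (proj2 hS) Sla; rewrite -/l gerDl leNgt a0.
Qed.

End Theory.
End MaximalIdeal.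

(** * Characters of a Banach f-algebra *)

Section Character.
Variables (R : realType) (A : banachFAlgType R).
Implicit Types (a b c x y e f : A) (phi : A -> R).

(** The zero functional is admitted, as [A] has no unit to normalize at. The
norm bound, which makes the character space compact, is built in. *)
Definition character phi :=
  [/\ forall (k : R) x y, phi (k *: x + y) = k * phi x + phi y,
      forall x y, phi (vmeet x y) = Num.min (phi x) (phi y),
      forall x y, phi (vjoin x y) = Num.max (phi x) (phi y),
      forall x y, phi (x ** y) = phi x * phi y &
      forall x, `|phi x| <= `|x|].

(** If [e] were in the ideal generated by [ppart (d *: e - f)], then
[ppart (f - d *: e)], being disjoint from that ideal, would be disjoint from
[e] and hence from [f], so that [f] would be at most [d *: e]. As [f] is not
zero, this fails for some [d]. *)
Lemma maximal_without_exists_gt e f (C : R) :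
  vle 0 e -> vle 0 f -> 0 <= C -> vle f (C *: e) -> f <> 0 ->
  exists M, maximal_without e M /\
    exists2 d : R, 0 < d & M (ppart (d *: e - f)).
Proof.
move=> e0 f0 C0 fC fn0; pose I d := ideal_adjoin [set 0] (ppart (d *: e - f)).
have Io d : order_ideal (I d) by exact/ideal_adjoin_order/order_ideal_zero.
have [[d d0 Ie]|allI] := pselect (exists2 d : R, 0 < d & ~ I d e).
  have [M maxM IM] := maximal_without_exists (Io d) Ie.
  exists M; split=> //; exists d => //; apply: IM.
  exact/ideal_adjoin_mem/order_ideal_zero.
exfalso; apply: fn0; apply: vle_eqP => //; apply: (@vle0_scale _ _ _ e) => d d0.
have [_ [-> [a a0]]] : I d e by apply: contrapT => Ie; apply: allI; exists d.
rewrite vabs0 add0r !vabs_id// => ea.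
have dis : vmeet (C *: e) (ppart (f - d *: e)) = 0.
  apply: vmeetZ_eq0 => //.
  apply: (disjoint_le e0 _ ea (vlexx _)) => //; apply: vmeetZ_eq0 => //.
  by rewrite -(opprB f) vmeetC ppart_disjoint.
have pC : vle (ppart (f - d *: e)) (C *: e).
  rewrite (vle_trans f)// ppart_le f0 vle_subl vle_addl//.
  exact: vscaler_ge0 (ltW d0) e0.
move: dis; rewrite vmeetC vmeet_idl// => p0.
by rewrite -[_ *: e]add0r -vle_subl -p0.
Qed.

Section MaximalCharacter.
Variables (e : A) (M : set A).
Hypotheses (e0 : vle 0 e) (maxM : maximal_without e M).

Let Mo : order_ideal M. Proof. by case: maxM. Qed.

Lemma standard_part_unique (k l : R) x :
  M (x - k *: e) -> M (x - l *: e) -> k = l.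
Proof.
move=> Mk Ml; have le0 := maximal_le0 e0 maxM.
have Mkl : M ((k - l) *: e).
  rewrite scalerBl -(subrKA x) -opprB addrC.
  exact: (idealB Mo).
apply/eqP; rewrite eq_le -[k <= l]subr_le0 -[l <= k]subr_le0.
by rewrite (le0 _ _ Mkl)//= (le0 _ _ (idealN Mo Mkl))// -opprB scaleNr.
Qed.

Let e_bound b : vle (vabs (b ** e)) (`|b| *: e).
Proof. by rewrite -{2}(vabs_id e0) vabs_amul_le_norm. Qed.

(** Multiplication by [b] is dominated by a multiple of the identity, so it
preserves [M] and acts as a scalar on the elements dominated by multiples of
[e], which form a line modulo [M]. *)
Lemma maximal_character : exists2 phi, character phi &
  forall b, M (b ** e - phi b *: e).
Proof.
have /choice[phi Mphi] b : exists l : R, M (b ** e - l *: e).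
  exact (maximal_standard_part e0 maxM (e_bound b)).
have phiE b l : M (b ** e - l *: e) -> phi b = l.
  exact: standard_part_unique (Mphi b).
have eo := ortho_amulr e0.
have leZ (k l : R) : k <= l -> vle (k *: e) (l *: e).
  by move=> kl; rewrite -vsub_ge0 -scalerBl vscaler_ge0 ?subr_ge0.
exists phi => //; split.
- move=> k x y; apply: phiE; rewrite amulDl amulZl scalerDl -scalerA.
  rewrite opprD addrACA -scalerBr.
  by apply: (idealD Mo) => //; apply: (idealZ Mo).
- move=> x y; apply: phiE; rewrite (ortho_vmeet eo).
  have -> : Num.min (phi x) (phi y) *: e = vmeet (phi x *: e) (phi y *: e).
    have [xy|/ltW xy] := leP (phi x) (phi y).
      by rewrite vmeet_idl// leZ.
    by rewrite vmeetC vmeet_idl// leZ.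
  exact: (ideal_vmeetB Mo).
- move=> x y; apply: phiE; rewrite (ortho_vjoin eo).
  have -> : Num.max (phi x) (phi y) *: e = vjoin (phi x *: e) (phi y *: e).
    have [xy|/ltW xy] := leP (phi x) (phi y).
      by rewrite vjoin_idr// leZ.
    by rewrite vjoinC vjoin_idr// leZ.
  exact: (ideal_vjoinB Mo).
- move=> x y; apply: phiE.
  have -> : (x ** y) ** e - (phi x * phi y) *: e =
      x ** (y ** e - phi y *: e) + phi y *: (x ** e - phi x *: e).
    rewrite amulBr amulA amulZr scalerBr scalerA addrA subrK.
    by rewrite [phi y * _]mulrC.
  apply: (idealD Mo); last exact: (idealZ Mo).
  apply: (ideal_solid Mo) (idealZ Mo `|x| (Mphi y)).
  by rewrite vabsZ normr_id vabs_amul_le_norm.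
- move=> x; rewrite -subr_le0.
  apply: (maximal_le0 e0 maxM (ideal_vabs Mo (Mphi x))).
  rewrite scalerBl vle_subl -[X in X *: e]normr_id.
  have -> : `| `|phi x| | *: e = vabs (- (phi x *: e)).
    by rewrite vabsN vabsZ normr_id (vabs_id e0).
  have := vabsD (x ** e - phi x *: e) (- (x ** e)).
  rewrite addrAC subrr add0r vabsN => /vle_trans; apply.
  by rewrite vabsN vleD2l.
Qed.

End MaximalCharacter.

Lemma character_vabs phi a : character phi -> phi a = 0 -> phi (vabs a) = 0.
Proof.
move=> [lin _ max _ _] a0; have phi0 : phi 0 = 0.
  by have := lin (-1) 0 0; rewrite scaler0 addr0; lra.
have Na0 : phi (- a) = 0.
  by have := lin (-1) a 0; rewrite addr0 scaleN1r a0 phi0; lra.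
by rewrite max a0 Na0 maxxx.
Qed.

(** The ideal [M] is such that [e ** e] is at least [d *: e] modulo [M], where
[e = vabs a]; a character with [phi e = 0] would put [e ** e] in [M]. *)
Lemma character_separates a : vabs a ** vabs a <> 0 ->
  exists2 phi, character phi & phi a <> 0.
Proof.
set e := vabs a => ee; have e0 : vle 0 e := vabs_ge0 a.
have [M [maxM [d d0 Md]]] := maximal_without_exists_gt e0 (amul_ge0 _ _ e0 e0)
  (normr_ge0 e) (amul_le_norm e0 e0) ee.
have [phi phiP Mphi] := maximal_character e0 maxM.
exists phi => // a0; have := Mphi e.
rewrite (character_vabs phiP a0) scale0r subr0.
have Mo : order_ideal M by case: maxM.
move=> Mee; have : d <= 0.
  by apply: (maximal_le0 e0 maxM (idealD Mo Md Mee)); rewrite -vle_subl.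
by rewrite leNgt d0.
Qed.

End Character.

(** * The character space *)

Section SubtypeTopology.
Variables (X : topologicalType) (C : set X).

Lemma set_type_compact : compact C -> compact [set: C].
Proof.
move=> cC F FF _; have [|p [Cp Fp]] := cC (set_val @ F) _.
  by apply: (@filterS _ F _ setT) filterT => x _; exact: set_valP.
exists (exist _ p (mem_set Cp)); split=> // D B FD.
move=> [_ [[U oU <-] /= Up UB]].
have [] := Fp (set_val @` D) U.
- by apply: (@filterS _ F _ D) FD => x Dx; exists x.
- by apply: open_nbhs_nbhs; split.
- by move=> _ [[x Dx <-] Ux]; exists x; split=> //; exact: UB.
Qed.

Lemma set_type_hausdorff : hausdorff_space X -> hausdorff_space C.
Proof.
move=> hX p q pq; apply: val_inj; apply: hX => U B Up Bq.
have [||x [Ux Bx]] := pq (set_val @^-1` U) (set_val @^-1` B).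
- exact: (@initial_continuous C X set_val p _ Up).
- exact: (@initial_continuous C X set_val q _ Bq).
- by exists (set_val x).
Qed.

End SubtypeTopology.

Lemma closure_preimage (X Y : topologicalType) (C : set X) (D : set Y)
    (g : X -> Y) (p : X) :
  continuous g -> closed D -> C `<=` g @^-1` D -> closure C p -> D (g p).
Proof.
move=> cg cD CD Cp; apply: cD => B /cg gB; have [q [Cq Bq]] := Cp _ gB.
by exists (g q); split=> //; exact: CD.
Qed.

Section Spectrum.
Variables (R : realType) (A : banachFAlgType R).

Let X : topologicalType := {ptws A -> R}.

Let eval_cts (a : A) : continuous (fun phi : X => phi a : R).
Proof. exact: (@proj_continuous A (fun _ => R) a). Qed.

Lemma character_closed : closed (character (A := A) : set X).
Proof.
have closure_eq (g h : X -> R) (p : X) : continuous g -> continuous h ->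
    (forall q, character (A := A) q -> g q = h q) ->
    closure (character (A := A) : set X) p -> g p = h p.
  move=> cg ch gh Cp; apply/eqP; rewrite -subr_eq0; apply/eqP.
  apply: (@closure_preimage X R _ [set 0] (fun q => g q - h q)) Cp.
  - by move=> q; exact: (@cvgB R R _ (nbhs q) _ g h _ _ (cg q) (ch q)).
  - exact/accessible_closed_set1/hausdorff_accessible/Rhausdorff.
  - by move=> q /gh /= ->; rewrite subrr.
move=> p Cp; split.
- move=> k x y; apply: (closure_eq (fun q => q (k *: x + y))
    (fun q => k * q x + q y)) Cp; first exact: eval_cts.
    move=> q.
    apply: (@cvgD R R _ (nbhs q) _ (fun q : X => k * q x) (fun q : X => q y)).
      apply: (@cvgMr R _ (nbhs q) _ (fun q : X => q x)); exact: eval_cts.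
    exact: eval_cts.
  by move=> q [].
- move=> x y; apply: (closure_eq (fun q => q (vmeet x y))
    (fun q => Num.min (q x) (q y))) Cp; first exact: eval_cts.
    by move=> q; apply: (@continuous_min R X (fun q => q x) (fun q => q y));
      exact: eval_cts.
  by move=> q [].
- move=> x y; apply: (closure_eq (fun q => q (vjoin x y))
    (fun q => Num.max (q x) (q y))) Cp; first exact: eval_cts.
    by move=> q; apply: (@continuous_max R X (fun q => q x) (fun q => q y));
      exact: eval_cts.
  by move=> q [].
- move=> x y; apply: (closure_eq (fun q => q (x ** y))
    (fun q => q x * q y)) Cp; first exact: eval_cts.
    move=> q.
    by apply: (@cvgM R _ (nbhs q) _ (fun q : X => q x) (fun q : X => q y));
      exact: eval_cts.
  by move=> q [].
- move=> x; apply: (@closure_preimage X R _ [set t | t <= `|x|]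
    (fun q => `|q x|)) Cp.
  + by move=> q; apply: (@cvg_norm R R _ (nbhs q) _ (fun q : X => q x));
      exact: eval_cts.
  + exact: closed_le.
  + by move=> q [_ _ _ _ qb] /=; exact: qb.
Qed.

Lemma character_compact : compact (character (A := A) : set X).
Proof.
apply: (@subclosed_compact X _
  [set p : X | forall a : A, `[- `|a|, `|a|]%classic (p a)]).
- exact: character_closed.
- apply: (@tychonoff A (fun _ => R) (fun a => `[- `|a|, `|a|]%classic)) => a.
  exact: segment_compact.
- by move=> p [_ _ _ _ pb] a; rewrite /= in_itv/= -ler_norml.
Qed.

Definition spectrum : Type := set_type (character (A := A) : set X).

HB.instance Definition _ := Topological.on spectrum.

Fact spectrum_compact : compact [set: spectrum].
Proof. exact: set_type_compact character_compact. Qed.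

Fact spectrum_hausdorff : hausdorff_space spectrum.
Proof.
apply: set_type_hausdorff; apply: hausdorff_product => _; exact: Rhausdorff.
Qed.

HB.instance Definition _ := Topological_isCompactHausdorff.Build spectrum
  spectrum_compact spectrum_hausdorff.

Lemma spectrum_character (p : spectrum) : character (set_val p : A -> R).
Proof. exact: set_valP p. Qed.

Lemma gelfand_cts (a : A) :
  continuous (fun p : spectrum => (set_val p : A -> R) a).
Proof.
move=> p; apply: (@continuous_comp _ _ _ (set_val : spectrum -> X)
  (fun q : X => q a)).
  exact: (@initial_continuous _ X set_val p).
exact: eval_cts.
Qed.

Definition gelfand (a : A) : cspace R spectrum := mkcspace (@gelfand_cts a).

Lemma norm_gelfand_le a : `|gelfand a| <= `|a|.
Proof.
apply: cspace_norm_le => // p.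
by have [_ _ _ _] := spectrum_character p; exact.
Qed.

Lemma gelfand_hom : lattice_algebra_hom gelfand.
Proof.
split=> [k x y|x y|x y|x y]; apply: cspaceP => p;
  have [lin meet join mul _] := spectrum_character p.
- exact: lin.
- exact: meet.
- exact: join.
- exact: mul.
Qed.

Lemma gelfand_eq0 a : gelfand a = 0 -> vabs a ** vabs a = 0.
Proof.
move=> a0; apply: contrapT => /character_separates[phi phiP]; apply.
pose ev (f : cspace R spectrum) := cspace_fun f (exist _ phi (mem_set phiP)).
exact: (congr1 ev a0).
Qed.

End Spectrum.

(** * The embedding *)

Lemma contractive_le (R : realType) (V W : normedModType R) (f : V -> W) :
  (forall x, `|f x| <= `|x|) -> contractive f.
Proof.
move=> fle; apply: ge_ereal_sup => _ [x /= x1 <-].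
by rewrite lee_fin (le_trans (fle x)).
Qed.

Definition nilpotent_disjoint_closedIdeal
    (R : realType) (A : banachFAlgType R) : closedIdeal A :=
  ClosedIdeal (@nilpotent_disjoint_ideal R A) (@nilpotent_disjoint_closed R A).

Unset Implicit Arguments.

Theorem theorem3p1 (R : realType) (A : banachFAlgType R) :
  exists (X : banachLatticeType R) (K : compactHausdorffType)
         (T : A -> dsum_infty (zero_product X) (cspace R K)),
    [/\ lattice_algebra_hom T, injective T & contractive T].
Proof.
pose J := nilpotent_disjoint_closedIdeal A.
exists (quotient J : banachLatticeType R), (spectrum A).
exists (fun a => (coset J a : zero_product _, gelfand a)).
have [glin gmeet gjoin gmul] := gelfand_hom A.
split.
- split=> [k x y|x y|x y|x y].
  + by rewrite glin cosetD cosetZ.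
  + by rewrite gmeet coset_vmeet.
  + by rewrite gjoin coset_vjoin.
  + rewrite gmul; congr pair; rewrite -[RHS](coset0 J); apply/coset_eqP.
    by rewrite subr0; exact: nilpotent_disjoint_amul.
- move=> x y Txy; have gxy : gelfand x = gelfand y := congr1 snd Txy.
  have /coset_eqP Jxy : coset J x = coset J y := congr1 fst Txy.
  apply/eqP; rewrite -subr_eq0; apply/eqP.
  apply: nilpotent_disjoint_eq0 Jxy _; apply: gelfand_eq0.
  by rewrite addrC -scaleN1r glin scaleN1r gxy addNr.
- apply: contractive_le => x; rewrite dsum_normE ge_max.
  by rewrite norm_gelfand_le (norm_coset_le J).
Qed.
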